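(* Let $K\ge1$ be a real number. Each $\mathfrak{RI}_K$-universal rational $K$-based Banach space $\mathbb U_K$ is $\mathfrak B$-isomorphic to the $\mathfrak B$-universal space $\mathbb U$ of Pełczyński.
   Context: All Banach spaces are separable and over $\mathbb R$. For a real $K\ge1$, a normalized $K$-suppression basis of a Banach space $X$ is a subset $B\subset X$ for which there is a family $(e_b^* )_{b\in B}$ of continuous linear functionals on $X$ such that: $\|b\|=1=e_b^*(b)$ for all $b\in B$; $e_b^*(b')=0$ for distinct $b,b'\in B$; $x=\sum_{b\in B}e_b^*(x)\,b$ for every $x\in X$ (meaning that for every $\varepsilon>0$ there is a finite $F\subset B$ with $\|x-\sum_{b\in E}e_b^*(x)b\|<\varepsilon$ for every finite $E$ with $F\subset E\subset B$); and for every finite $F\subset B$ the projection $x\mapsto\sum_{b\in F}e_b^*(x)b$ has norm $\le K$. A $K$-based Banach space is a pair $(X,B_X)$ consisting of a Banach space $X$ and a normalized $K$-suppression basis $B_X$ of $X$ (the trivial space $\{0\}$ with empty basis is allowed). A based Banach space is a $K$-based Banach space for some $K\ge1$. A based Banach space $(X,B_X)$ is a (based) subspace of a based Banach space $(Y,B_Y)$ if $X\subseteq Y$ (a closed linear subspace with the restricted norm) and $B_X=X\cap B_Y$. A $\mathfrak B$-morphism $(X,B_X)\to(Y,B_Y)$ is a continuous linear operator $T:X\to Y$ with $T(B_X)\subseteq B_Y$; a $\mathfrak B$-isomorphism is a $\mathfrak B$-morphism with a two-sided inverse that is a $\mathfrak B$-morphism (equivalently, a linear homeomorphism $T$ of $X$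 onto $Y$ with $T(B_X)=B_Y$). An isometry morphism is a $\mathfrak B$-morphism $T$ with $\|T(x)\|_Y=\|x\|_X$ for all $x\in X$. A finite-dimensional based Banach space $(X,B_X)$ is rational if its closed unit ball is the convex hull of finitely many vectors having rational coordinates in $B_X$. An arbitrary based Banach space is rational if each of its finite-dimensional based subspaces is rational. A based Banach space $X$ is $\mathfrak{RI}_K$-universal if for any rational finite-dimensional $K$-based Banach space $A$, any isometry morphism $f:\Lambda\to X$ defined on a based subspace $\Lambda$ of $A$ can be extended to an isometry morphism $\bar f:A\to X$. A based Banach space $U$ is $\mathfrak B$-universal if each based Banach space $X$ is $\mathfrak B$-isomorphic to a based subspace of $U$. Pełczyński (1969) constructed a $\mathfrak B$-universal based Banach space, denoted $\mathbb U$, and proved that any two $\mathfrak B$-universal based Banach spaces are $\mathfrak B$-isomorphic; thus $\mathbb U$ is, up to $\mathfrak B$-isomorphism, the unique $\mathfrak B$-universal based Banach space. *)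

(* Defs.v *)
From HB Require Import structures.
From mathcomp Require Import all_boot all_order all_algebra finmap.
From mathcomp Require Import all_classical all_reals all_analysis.

Set Implicit Arguments.
Unset Strict Implicit.
Unset Printing Implicit Defensive.

Import Order.TTheory GRing.Theory Num.Theory.
Import numFieldNormedType.Exports.

Local Open Scope classical_set_scope.
Local Open Scope ring_scope.

(* A Banach space is a closed linear subspace [L : set X] of a complete normed
   space [X : completeNormedModType R]; a space that is not given as a subspace
   of another one is [setT].  Thus a based subspace is literally a subset.
   Maps out of [L] are total functions on [X] whose values outside [L] are
   irrelevant: linearity, continuity and equality are only required on [L]. *)

Section BasedBanachSpaces.
Variable R : realType.

Definition linear_on (X V : lmodType R) (L : set X) (T : X -> V) : Prop :=
  forall (a : R) (x y : X), L x -> L y -> T (a *: x + y) = a *: T x + T y.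

Section OneSpace.
Variable X : completeNormedModType R.
Implicit Types (L B : set X) (F E : {fset X}).

Definition separable_set L : Prop :=
  exists D : set X, [/\ countable D, D `<=` L & L `<=` closure D].

Definition separable_banach L : Prop :=
  [/\ submod_closed [in L], closed L & separable_set L].

(* [e b] is the coordinate functional of [b \in B]; it is unconstrained for
   [b \notin B] and outside [L]. The last clause says that the projection onto
   the coordinates in [F] has norm at most [K]. *)
Definition suppression_basis (K : R) L B : Prop :=
  B `<=` L /\
  exists e : X -> X -> R^o,
    [/\ forall b, B b -> linear_on L (e b) /\ {within L, continuous (e b)},
        forall b, B b -> `|b| = 1 /\ e b b = 1,
        forall b b', B b -> B b' -> b <> b' -> e b b' = 0,
        forall x, L x -> forall eps : R, 0 < eps ->
          exists F, [set` F] `<=` B /\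
            forall E, [set` F] `<=` [set` E] -> [set` E] `<=` B ->
              `|x - \sum_(b <- E) e b x *: b| < eps
      & forall F, [set` F] `<=` B ->
          forall x, L x -> `|\sum_(b <- F) e b x *: b| <= K * `|x| ].

Definition K_based (K : R) L B : Prop :=
  [/\ 1 <= K, separable_banach L & suppression_basis K L B].

Definition based L B : Prop := exists K : R, K_based K L B.

Definition based_subspace L BL M BM : Prop :=
  [/\ based L BL, based M BM, L `<=` M & BL = L `&` BM].

Definition finite_dimensional L : Prop :=
  exists F, [set` F] `<=` L /\
    forall x, L x -> exists c : X -> R, x = \sum_(v <- F) c v *: v.

Definition rational_coordinates B (x : X) : Prop :=
  exists F (q : X -> rat),
    [set` F] `<=` B /\ x = \sum_(b <- F) ratr (q b) *: b.

Definition convex_hull (S : set X) : set X := smallest (@convex_set R X) S.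

Definition fd_rational L B : Prop :=
  exists S : {fset X},
    [set` S] `<=` rational_coordinates B /\
    L `&` [set x | `|x| <= 1] = convex_hull [set` S].

Definition rational_based L B : Prop :=
  forall L' B', based_subspace L' B' L B -> finite_dimensional L' ->
    fd_rational L' B'.

End OneSpace.

Definition B_morphism (X Y : completeNormedModType R)
    (L B : set X) (M C : set Y) (T : X -> Y) : Prop :=
  [/\ linear_on L T, {within L, continuous T}, T @` L `<=` M
    & T @` B `<=` C].

Definition B_isomorphic (X Y : completeNormedModType R)
    (L B : set X) (M C : set Y) : Prop :=
  exists (T : X -> Y) (S : Y -> X),
    [/\ B_morphism L B M C T, B_morphism M C L B S,
        forall x, L x -> S (T x) = x & forall y, M y -> T (S y) = y].

Definition isometry_morphism (X Y : completeNormedModType R)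
    (L B : set X) (M C : set Y) (T : X -> Y) : Prop :=
  B_morphism L B M C T /\ forall x, L x -> `|T x| = `|x|.

Definition RI_universal (K : R) (X : completeNormedModType R) (L B : set X) :
    Prop :=
  forall (A : completeNormedModType R) (BA Lam BLam : set A) (f : A -> X),
    K_based K setT BA -> finite_dimensional [set: A] -> fd_rational setT BA ->
    based_subspace Lam BLam setT BA ->
    isometry_morphism Lam BLam L B f ->
    exists g : A -> X,
      isometry_morphism setT BA L B g /\ forall x, Lam x -> g x = f x.

Definition B_universal (U : completeNormedModType R) (L B : set U) : Prop :=
  forall (X : completeNormedModType R) (BX : set X), based setT BX ->
    exists M BM, based_subspace M BM L B /\ B_isomorphic setT BX M BM.

End BasedBanachSpaces.

(* Main.v *)
Require Import Defs.
From HB Require Import structures.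
From mathcomp Require Import all_boot all_order all_algebra finmap.
From mathcomp Require Import all_classical all_reals all_analysis.
From mathcomp Require Import ring.

(** Two based Banach spaces are isomorphic as soon as each of them embeds into
    the other along the bases ([based_cantor_bernstein]). Indeed, combine the
    two injections of bases into a bijection as in the Cantor-Bernstein
    theorem: it coincides with one injection on a part of the basis and with
    the inverse of the other injection on the rest. Both bases are
    unconditional, so every finite sum is controlled from above and from below
    on each part separately, and the bijection of bases extends to a linear
    homeomorphism.

    The space [UK] embeds into [U] because [U] is universal
    ([B_isomorphic_embedding]). To embed [U] into [UK]
    ([RI_universal_embedding]), list the basis of [U] as a sequence [b] and
    look for an equivalent norm on finite sequences of coefficients whose
    restriction to the first [n] coordinates is rational and 1-suppression for
    every [n]. Such a norm is the gauge of the convex hull of the following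
    set: all finite sequences [x] with [x_i] an integer multiple of
    [2^-(i+2)], of absolute value at most 1, such that all the partial sums of
    the [x_i b_i], over arbitrary sets of indices, have norm at most 1.

    - In each dimension this set is finite, consists of rational vectors, and is
      stable under coordinate projections. So the gauge is polyhedral with
      rational vertices, the coordinate projections have norm at most 1
      ([polyhedral_K_based], [polyhedral_rational]), and truncation makes the
      norms of consecutive dimensions compatible ([grid_norm_trunc]).
    - The gauge is at least the norm of [sum x_i b_i] ([grid_norm_ge]). It is at
      most three times the largest norm of a partial sum ([grid_norm_le]),
      because the total mesh of the grid is 1/2, so that rounding to the grid is
      cheap. In an unconditional basis that largest norm is equivalent to the
      norm.

    Universality of [UK] for rational finite-dimensional spaces then provides,
    one vector at a time, basis vectors of [UK] that span an isometric copy of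
    this norm ([copies_sequence]). *)

Set Implicit Arguments.
Unset Strict Implicit.
Unset Printing Implicit Defensive.

Import Order.TTheory GRing.Theory Num.Theory.
Import numFieldNormedType.Exports.

Local Open Scope classical_set_scope.
Local Open Scope ring_scope.

(** * Linear maps on a subspace *)

Section LinearOn.
Variables (R : realType) (X V : normedModType R) (L : set X) (T : X -> V).
Hypotheses (L_sub : submod_closed [in L]) (T_lin : linear_on L T).

Lemma submod_in0 : L 0.
Proof. by have [] := L_sub; rewrite inE. Qed.

Lemma submod_in_lin (a : R) x y : L x -> L y -> L (a *: x + y).
Proof. by move=> Lx Ly; have [_ /(_ a x y)] := L_sub; rewrite !inE; exact. Qed.

Lemma submod_inB x y : L x -> L y -> L (x - y).
Proof.
by move=> Lx Ly; rewrite addrC -scaleN1r; exact: submod_in_lin.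
Qed.

Lemma linear_on0 : T 0 = 0.
Proof.
have := T_lin 1 submod_in0 submod_in0; rewrite !scale1r addr0 => /eqP.
by rewrite -subr_eq subrr eq_sym => /eqP.
Qed.

Lemma linear_onZ a x : L x -> T (a *: x) = a *: T x.
Proof. by move=> Lx; rewrite -[a *: x]addr0 (T_lin _ Lx submod_in0) linear_on0 addr0. Qed.

Lemma linear_onB x y : L x -> L y -> T (x - y) = T x - T y.
Proof. by move=> Lx Ly; rewrite addrC -scaleN1r T_lin// scaleN1r addrC. Qed.

Lemma linear_on_sum (I : Type) (s : seq I) (a : I -> R) (v : I -> X) :
  (forall i, L (v i)) ->
  T (\sum_(i <- s) a i *: v i) = \sum_(i <- s) a i *: T (v i).
Proof.
move=> Lv; have : L (\sum_(i <- s) a i *: v i) /\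
    T (\sum_(i <- s) a i *: v i) = \sum_(i <- s) a i *: T (v i); last by case.
elim: s => [|i s [Ls ih]].
  by rewrite !big_nil linear_on0; split => //; exact: submod_in0.
by rewrite !big_cons T_lin// ih; split=> //; exact: submod_in_lin.
Qed.

Lemma bounded_linear_on_continuous (C : R) :
  (forall x, L x -> `|T x| <= C * `|x|) -> {within L, continuous T}.
Proof.
move=> TC; apply/subspace_continuousP => x Lx.
apply/cvgrPdist_lt => e e0.
have d0 : 0 < e / (`|C| + 1) by rewrite divr_gt0// ltr_wpDl.
rewrite near_withinE; near=> y => Ly; rewrite -linear_onB//.
rewrite (le_lt_trans (TC _ (submod_inB Lx Ly)))//.
rewrite (@le_lt_trans _ _ ((`|C| + 1) * `|x - y|))//.
  by rewrite ler_wpM2r// (le_trans (ler_norm C))// lerDl.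
rewrite mulrC -ltr_pdivlMr ?ltr_wpDl//.
Unshelve. all: by end_near. Qed.

(** Vectors are rescaled into a ball on which [T] is bounded by 1; the scaled
    vectors stay in [L], which is all that is known about the domain. *)
Lemma continuous_linear_on_bounded :
  {within L, continuous T} -> exists C, forall x, L x -> `|T x| <= C * `|x|.
Proof.
move=> /subspace_continuousP /(_ 0 submod_in0) /cvgrPdist_lt /(_ 1 ltr01).
rewrite /prop_near1/within /= => /nbhs_ballP[d /= d0 dT].
exists (2 / d) => x Lx; have [->|x0] := eqVneq x 0.
  by rewrite linear_on0 !normr0 mulr0.
have nx0 : 0 < `|x| by rewrite normr_gt0.
pose t := d / 2 / `|x|.
have t0 : 0 < t by rewrite !divr_gt0.
have Ltx : L (t *: x) by rewrite -[t *: x]addr0; apply: submod_in_lin => //; exact: submod_in0.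
have := dT (t *: x).
rewrite -ball_normE /ball_/= sub0r normrN normrZ gtr0_norm// /t divfK ?gt_eqF//.
rewrite -/t /from_subspace/= linear_on0 sub0r normrN linear_onZ// normrZ gtr0_norm//.
rewrite ltr_pdivrMr// ltr_pMr// ltr1n => /(_ isT Ltx) /ltW tT.
rewrite -(ler_pM2l t0) (le_trans tT)//.
rewrite (_ : t * _ = 1)// /t; field.
by rewrite (gt_eqF nx0) (gt_eqF d0).
Qed.

End LinearOn.

Lemma submod_closed_setT (R : realType) (X : lmodType R) : submod_closed [in [set: X]].
Proof. by split=> [|a x y _ _]; rewrite inE. Qed.

(** * Domination between families of vectors, and unconditional sums *)

(** The assignment [u i |-> v i] extends to a bounded operator between the
    spans. Speaking of families rather than of operators, the constructions
    below (restriction, reindexing, gluing) involve finite sums only. *)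
Definition dominates (R : realType) (I : choiceType) (P : set I)
    (X Y : normedModType R) (u : I -> X) (v : I -> Y) : Prop :=
  exists C : R, forall (s : {fset I}) (a : I -> R), [set` s] `<=` P ->
    `|\sum_(i <- s) a i *: v i| <= C * `|\sum_(i <- s) a i *: u i|.

Section Families.
Variables (R : realType) (I : choiceType).

Lemma sub_dominates (P Q : set I) (X Y : normedModType R) (u : I -> X) (v : I -> Y) :
  Q `<=` P -> dominates P u v -> dominates Q u v.
Proof. by move=> QP [C uv]; exists C => s a sQ; apply: uv => i /sQ /QP. Qed.

Lemma eq_dominates (P : set I) (X Y : normedModType R) (u u' : I -> X) (v v' : I -> Y) :
  (forall i, P i -> u i = u' i) -> (forall i, P i -> v i = v' i) ->
  dominates P u v -> dominates P u' v'.
Proof.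
move=> uu' vv' [C uv]; exists C => s a sP.
have -> : \sum_(i <- s) a i *: v' i = \sum_(i <- s) a i *: v i.
  by rewrite big_seq [RHS]big_seq; apply: eq_bigr => i /sP /vv' ->.
have -> : \sum_(i <- s) a i *: u' i = \sum_(i <- s) a i *: u i.
  by rewrite big_seq [RHS]big_seq; apply: eq_bigr => i /sP /uu' ->.
exact: uv.
Qed.

Lemma dominates_inj (P : set I) (X Y : normedModType R) (u : I -> X) (v : I -> Y) :
  dominates P u v -> forall i j, P i -> P j -> u i = u j -> v i = v j.
Proof.
move=> [C uv] i j Pi Pj uij; have [->//|ij] := eqVneq i j.
have := uv [fset i; j]%fset (fun k => if k == i then 1 else -1).
have sumE (Z : normedModType R) (w : I -> Z) :
    \sum_(k <- [fset i; j]%fset) (if k == i then 1 else -1) *: w k = w i - w j.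
  rewrite big_fsetU1 ?inE//= big_seq_fset1 eqxx eq_sym (negbTE ij).
  by rewrite scale1r scaleN1r.
rewrite !sumE uij subrr normr0 mulr0 normr_le0 subr_eq0 => H; apply/eqP/H.
by move=> k /=; rewrite !inE => /orP[] /eqP ->.
Qed.

(** For a family that enumerates part of a [K]-suppression basis, this is the
    bound on the coordinate projections, read on finite sums. *)
Definition suppressive (P : set I) (X : normedModType R) (u : I -> X) (K : R) :=
  forall (s : {fset I}) (a : I -> R) (Q : pred I), [set` s] `<=` P ->
    `|\sum_(i <- s | Q i) a i *: u i| <= K * `|\sum_(i <- s) a i *: u i|.

Lemma suppressive_dominated (P P' : set I) (X Y : normedModType R)
    (u : I -> X) (v : I -> Y) (K C : R) (s : {fset I}) (a : I -> R) (Q : pred I) :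
  suppressive P u K -> [set` s] `<=` P ->
  (forall (t : {fset I}) (a : I -> R), [set` t] `<=` P' ->
    `|\sum_(i <- t) a i *: v i| <= C * `|\sum_(i <- t) a i *: u i|) ->
  (forall i, i \in s -> Q i -> P' i) ->
  `|\sum_(i <- s | Q i) a i *: v i| <= `|C| * K * `|\sum_(i <- s) a i *: u i|.
Proof.
move=> uK sP uv QP'; have sQ : [set` [fset i in s | Q i]%fset] `<=` P'.
  by move=> i /=; rewrite !inE => /andP[/= ? ?]; exact: QP'.
have := uv _ a sQ; rewrite -!big_fset_condE => /le_trans; apply.
rewrite -mulrA (@le_trans _ _ (`|C| * `|\sum_(i <- s | Q i) a i *: u i|))//.
  by apply: ler_wpM2r => //; exact: ler_norm.
by apply: ler_wpM2l => //; exact: uK.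
Qed.

(** This is where unconditionality enters: a finite sum over the union splits
    into two partial sums, and each of them is controlled by the whole sum. *)
Lemma dominatesU (P Q : set I) (X Y : normedModType R) (u : I -> X) (v : I -> Y) K :
  suppressive (P `|` Q) u K ->
  dominates P u v -> dominates Q u v -> dominates (P `|` Q) u v.
Proof.
move=> uK [C uvP] [D uvQ]; exists (`|C| * K + `|D| * K) => s a sPQ.
rewrite (bigID (fun i => `[< P i >]))/= (le_trans (ler_normD _ _))// mulrDl lerD//.
  by apply: (suppressive_dominated _ uK sPQ uvP) => i _ /asboolP.
apply: (suppressive_dominated _ uK sPQ uvQ) => i is_ /asboolPn nP.
by case: (sPQ _ is_).
Qed.

End Families.

Lemma dominates_reindex (R : realType) (I J : choiceType) (P : set I) (Q : set J)
    (X Y : normedModType R) (u : I -> X) (v : I -> Y) (w : J -> I) :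
  (forall j, Q j -> P (w j)) -> (forall i j, Q i -> Q j -> w i = w j -> i = j) ->
  dominates P u v -> dominates Q (u \o w) (v \o w).
Proof.
move=> wQ w_inj [C uv]; exists C => s a sQ.
have w_inj' : {in s &, injective w}.
  by move=> i j /sQ Qi /sQ Qj; exact: w_inj.
(* The coefficients are carried along the injection [w]. *)
have [a' a'E] : exists a' : I -> R, forall j, j \in s -> a' (w j) = a j.
  exists (fun i => if pselect (exists2 j, j \in s & w j = i) is left h
                   then a (projT1 (cid2 h)) else 0) => j js.
  case: pselect => [h|[]]; last by exists j.
  by case: cid2 => k /= ks kj; rewrite (w_inj' k j ks js kj).
have sumE (Z : normedModType R) (z : I -> Z) :
    \sum_(j <- s) a j *: (z \o w) j = \sum_(i <- [fset w j | j in s]%fset) a' i *: z i.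
  rewrite big_imfset//= big_seq [RHS]big_seq; apply: eq_bigr => j js.
  by rewrite a'E.
rewrite !sumE; apply: uv => i /= /imfsetP[j /= js ->]; exact/wQ/sQ.
Qed.

Section Basis.
Variables (R : realType) (X : completeNormedModType R) (B : set X) (K : R).
Hypothesis B_basis : suppression_basis K setT B.

(** The coordinate functionals recover the coefficients of a finite sum, so
    its partial sums are its images under coordinate projections. *)
Lemma suppressive_basis (I : choiceType) (P : set I) (u : I -> X) :
  (forall i, P i -> B (u i)) -> (forall i j, P i -> P j -> u i = u j -> i = j) ->
  suppressive P u K.
Proof.
move=> uB u_inj s a Q sP; have [_ [e [e_lin e1 e0 _ eK]]] := B_basis.
set x := \sum_(i <- s) a i *: u i.
have eu j : j \in s -> e (u j) x = a j.
  move=> js; have [ej _] := e_lin _ (uB _ (sP _ js)).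
  rewrite /x (linear_on_sum (submod_closed_setT _) ej)// (big_fsetD1 j)//=.
  rewrite (e1 _ (uB _ (sP _ js))).2 [X in X + _]mulr1 big1_fset ?addr0// => i.
  rewrite !inE => /andP[ij is_] _; rewrite e0 ?scaler0//; [exact/uB/sP|exact/uB/sP|].
  by move=> /u_inj ji; rewrite ji ?eqxx// in ij; exact: sP.
pose t := [fset i in s | Q i]%fset.
have ts i : i \in t -> i \in s by rewrite !inE => /andP[].
have tF : [set` [fset u i | i in t]%fset] `<=` B.
  by move=> _ /= /imfsetP[i /= /ts /sP /uB ? ->].
have := eK _ tF x Logic.I; rewrite big_imfset/=; last first.
  by move=> i j /ts /sP Pi /ts /sP Pj; exact: u_inj.
congr (`|_| <= _); rewrite [RHS]big_fset_condE/= big_seq [RHS]big_seq.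
by apply: eq_bigr => i /ts it; rewrite eu.
Qed.

Lemma suppressive_id : suppressive B id K.
Proof. exact: suppressive_basis. Qed.
End Basis.

(** [y] is the unconditional sum of the [c i *: w i], in the form that the
    expansion of a vector takes in [suppression_basis]. *)
Definition sums_to (R : realType) (I : choiceType) (P : set I) (Y : normedModType R)
    (c : I -> R) (w : I -> Y) (y : Y) : Prop :=
  forall eps : R, 0 < eps -> exists F : {fset I}, [set` F] `<=` P /\
    forall E : {fset I}, [set` F] `<=` [set` E] -> [set` E] `<=` P ->
      `|y - \sum_(i <- E) c i *: w i| < eps.

Section SumsTo.
Variables (R : realType) (I : choiceType) (P : set I).

Lemma fsetU_sub (E F : {fset I}) :
  [set` E] `<=` P -> [set` F] `<=` P -> [set` (E `|` F)%fset] `<=` P.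
Proof. by move=> EP FP i /=; rewrite inE => /orP[/EP|/FP]. Qed.

Lemma sums_to_unique (Y : normedModType R) (c : I -> R) (w : I -> Y) y z :
  sums_to P c w y -> sums_to P c w z -> y = z.
Proof.
move=> cy cz; apply/eqP; rewrite -subr_eq0 -normr_le0; apply/ler_addgt0Pl => e e0.
have e2 : 0 < e / 2 by rewrite divr_gt0.
have [F [FP yF]] := cy _ e2; have [G [GP zG]] := cz _ e2.
have FG := fsetU_sub FP GP.
have {}yF := yF _ (fun i h => introT (fsetUP _ _ _) (or_introl h)) FG.
have {}zG := zG _ (fun i h => introT (fsetUP _ _ _) (or_intror h)) FG.
rewrite addr0 (splitr e).
set S := \sum_(i <- _) _ in yF zG.
rewrite (_ : y - z = (y - S) - (z - S)); last by rewrite opprB addrA subrK.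
by rewrite (le_trans (ler_normB _ _))// lerD// ltW.
Qed.

Lemma sums_to_lin (Y : normedModType R) (a : R) (c d e : I -> R) (w : I -> Y) y z :
  (forall i, P i -> e i = a * c i + d i) ->
  sums_to P c w y -> sums_to P d w z -> sums_to P e w (a *: y + z).
Proof.
move=> eE cy dz eps eps0.
have e1 : 0 < eps / 2 / (`|a| + 1) by rewrite !divr_gt0// ltr_wpDl.
have e2 : 0 < eps / 2 by rewrite divr_gt0.
have [F [FP yF]] := cy _ e1; have [G [GP zG]] := dz _ e2.
exists (F `|` G)%fset; split; first exact: fsetU_sub.
move=> E FGE EP.
have {}yF : `|y - \sum_(i <- E) c i *: w i| < eps / 2 / (`|a| + 1).
  by apply: yF => // i /= iF; apply: FGE; rewrite /= inE iF.
have {}zG : `|z - \sum_(i <- E) d i *: w i| < eps / 2.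
  by apply: zG => // i /= iF; apply: FGE; rewrite /= inE iF orbT.
have -> : \sum_(i <- E) e i *: w i = a *: (\sum_(i <- E) c i *: w i) + \sum_(i <- E) d i *: w i.
  rewrite scaler_sumr -big_split/= big_seq [RHS]big_seq; apply: eq_bigr => i iE.
  by rewrite eE ?scalerDl ?scalerA//; exact: EP.
rewrite opprD addrACA -scalerBr (le_lt_trans (ler_normD _ _))// (splitr eps).
rewrite ler_ltD// normrZ; move: yF; rewrite ltr_pdivlMr ?ltr_wpDl// => /ltW.
by apply: le_trans; rewrite mulrC ler_wpM2l// lerDl.
Qed.

Lemma sums_to_le (Y : normedModType R) (c : I -> R) (w : I -> Y) y M :
  (forall E : {fset I}, [set` E] `<=` P -> `|\sum_(i <- E) c i *: w i| <= M) ->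
  sums_to P c w y -> `|y| <= M.
Proof.
move=> cM cy; apply/ler_addgt0Pl => e e0.
have [F [FP /(_ F (fun _ => id) FP) yF]] := cy _ e0.
rewrite -[y](subrK (\sum_(i <- F) c i *: w i)) (le_trans (ler_normD _ _))//.
by rewrite lerD ?cM ?(ltW yF).
Qed.

Lemma sums_to1 (Y : normedModType R) (c : I -> R) (w : I -> Y) i0 :
  P i0 -> c i0 = 1 -> (forall i, P i -> i <> i0 -> c i = 0) -> sums_to P c w (w i0).
Proof.
move=> Pi0 ci0 c0 e e_gt0; exists [fset i0]%fset; split.
  by move=> i /=; rewrite inE => /eqP ->.
move=> E i0E EP; have iE : i0 \in E by apply: i0E; rewrite /= inE.
rewrite (big_fsetD1 i0)//= ci0 scale1r big1_fset ?addr0 ?subrr ?normr0// => i.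
by rewrite !inE => /andP[/eqP ii0 /EP Pi] _; rewrite c0 ?scale0r.
Qed.

(** Replacing coefficients by zero on [F] turns a difference of two partial
    sums into one sum over [E], to which a domination bound applies. *)
Lemma sum_fset_diff (Y : lmodType R) (c : I -> R) (w : I -> Y) (E F : {fset I}) :
  (F `<=` E)%fset ->
  \sum_(i <- E) (if i \in F then 0 else c i) *: w i =
  \sum_(i <- E) c i *: w i - \sum_(i <- F) c i *: w i.
Proof.
move=> FE; rewrite [X in _ = _ - X](_ : _ = \sum_(i <- E) (if i \in F then c i else 0) *: w i).
  rewrite -sumrB; apply: eq_bigr => i _.
  by case: ifP; rewrite !scale0r ?subrr ?subr0.
rewrite big_seq (eq_bigr (fun i => (if i \in F then c i else 0) *: w i)); last by move=> i ->.
rewrite -big_seq; apply: big_fset_incl => // i _ /negbTE ->; exact: scale0r.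
Qed.

(** Domination transports the Cauchy property from the partial sums of [u] to
    those of [v], and [Y] is complete. *)
Lemma sums_to_dominated (X : normedModType R) (Y : completeNormedModType R)
    (c : I -> R) (u : I -> X) (v : I -> Y) x :
  dominates P u v -> sums_to P c u x -> exists y, sums_to P c v y.
Proof.
move=> [C uv] cx.
pose G : set_system Y := filter_from [set F : {fset I} | [set` F] `<=` P]
  (fun F => [set \sum_(i <- E) c i *: v i | E in
     [set E : {fset I} | [set` F] `<=` [set` E] /\ [set` E] `<=` P]]).
have GF : ProperFilter G.
  apply: filter_from_proper; last first.
    by move=> F FP; exists (\sum_(i <- F) c i *: v i), F => //; split.
  apply: filter_from_filter; first by exists fset0 => i /=; rewrite inE.
  move=> E F EP FP; exists (E `|` F)%fset; first exact: fsetU_sub.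
  move=> _ [D [EFD DP] <-]; split; exists D => //; split=> // i iE; apply: EFD.
    by rewrite /= inE iE.
  by rewrite /= inE iE orbT.
have Gc : cauchy G.
  apply: cauchy_exP => e e0.
  have e1 : 0 < e / (2 * (`|C| + 1)) by rewrite divr_gt0// mulr_gt0// ltr_wpDl.
  have [F [FP xF]] := cx _ e1.
  exists (\sum_(i <- F) c i *: v i); exists F => //= _ [E [FE EP] <-].
  rewrite -ball_normE /ball_/= distrC.
  have FE' : (F `<=` E)%fset by apply/fsubsetP => i; exact: FE.
  have := uv E (fun i => if i \in F then 0 else c i) EP.
  rewrite !sum_fset_diff// => /le_lt_trans; apply.
  rewrite (@le_lt_trans _ _ (`|C| * `|\sum_(i <- E) c i *: u i - \sum_(i <- F) c i *: u i|))//.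
    by rewrite ler_wpM2r ?ler_norm.
  have xE := xF E FE EP; have {}xF := xF F (fun _ => id) FP.
  set SE := \sum_(i <- E) _ in xE *; set SF := \sum_(i <- F) _ in xF *.
  have : `|SE - SF| < e / (`|C| + 1).
    rewrite (_ : SE - SF = (x - SF) - (x - SE)); last first.
      by rewrite opprB [RHS]addrC addrA subrK.
    rewrite (le_lt_trans (ler_normB _ _))// (lt_le_trans (ltrD xF xE))//.
    rewrite (_ : _ + _ = e / (`|C| + 1))//; field.
    by rewrite gt_eqF// ltr_wpDl.
  rewrite ltr_pdivlMr ?ltr_wpDl//; apply: le_lt_trans.
  by rewrite mulrC ler_wpM2l// lerDl.
have /cvg_ex[/= y Gy] := @cauchy_cvg Y _ GF Gc.
exists y => e e0; have [F FP FE] := Gy _ (nbhsx_ballx y e e0).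
exists F; split => // E FE' EP.
have : ball y e (\sum_(i <- E) c i *: v i) by apply: FE; exists E.
by rewrite -ball_normE.
Qed.
End SumsTo.

(** * The Cantor-Bernstein theorem for based spaces *)

Section Extension.
Variables (R : realType) (X Y : completeNormedModType R).
Variables (B : set X) (K : R) (h : X -> Y).
Hypothesis B_basis : suppression_basis K setT B.

(** The operator sends [x] to the sum of the [e b x *: h b]. The partial sums
    of this series are bounded by [C * K * `|x|], with [C] the domination
    constant, hence so is its sum. *)
Lemma basis_operator : dominates B id h ->
  exists T : X -> Y, [/\ linear_on setT T, {within setT, continuous T}
    & forall b, B b -> T b = h b].
Proof.
move=> hB; have [C hC] := hB.
have [_ [e [e_lin e1 e0 e_sum eK]]] := B_basis.
have x_sum x : sums_to B (e ^~ x) id x by move=> eps eps0; exact: e_sum.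
have /choice[T Tx] : forall x, exists y, sums_to B (e ^~ x) h y.
  by move=> x; exact: (sums_to_dominated hB (x_sum x)).
have T_lin : linear_on setT T.
  move=> a x y _ _; apply: (sums_to_unique (Tx _)).
  apply: sums_to_lin (Tx x) (Tx y) => b Bb.
  exact: (e_lin b Bb).1.
exists T; split => //.
  apply: (bounded_linear_on_continuous (submod_closed_setT _) T_lin (C := `|C| * K)).
  move=> x _; apply: sums_to_le (Tx x) => E EB.
  rewrite (le_trans (hC E (e ^~ x) EB))//.
  rewrite (@le_trans _ _ (`|C| * `|\sum_(b <- E) e b x *: b|))//.
    by apply: ler_wpM2r => //; exact: ler_norm.
  by rewrite -mulrA; apply: ler_wpM2l => //; exact: eK.
move=> b Bb; apply: (sums_to_unique (Tx b)).
apply: (sums_to1 (c := fun b0 => e b0 b) h Bb); first exact: (e1 b Bb).2.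
by move=> b' Bb' bb'; exact: e0.
Qed.

(** Finite sums of basis vectors are dense. *)
Lemma operator_eq_on_basis (T S : X -> Y) :
  linear_on setT T -> {within setT, continuous T} ->
  linear_on setT S -> {within setT, continuous S} ->
  (forall b, B b -> T b = S b) -> forall x, T x = S x.
Proof.
move=> Tl Tc Sl Sc TS x.
have [_ [e [_ _ _ e_sum _]]] := B_basis.
have Xs := submod_closed_setT X.
have [C TC] := continuous_linear_on_bounded Xs Tl Tc.
have [D SD] := continuous_linear_on_bounded Xs Sl Sc.
apply/eqP; rewrite -subr_eq0 -normr_le0; apply/ler_addgt0Pl => eps eps0; rewrite addr0.
have CD0 : 0 < `|C| + `|D| + 1 by rewrite ltr_wpDl// addr_ge0.
have [F [FB /(_ F (fun _ => id) FB) xF]] := e_sum x Logic.I _ (divr_gt0 eps0 CD0).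
set s := \sum_(b <- F) _ in xF.
have sTS : T s = S s.
  rewrite /s (linear_on_sum Xs Tl)// (linear_on_sum Xs Sl)//.
  by rewrite big_seq [RHS]big_seq; apply: eq_bigr => b /FB Bb; rewrite TS.
have -> : T x - S x = T (x - s) - S (x - s).
  by rewrite (linear_onB Tl)// (linear_onB Sl)// sTS opprB addrA subrK.
rewrite (le_trans (ler_normB _ _))// (le_trans (lerD (TC _ Logic.I) (SD _ Logic.I)))//.
rewrite -mulrDl; move: xF; rewrite ltr_pdivlMr// => /ltW; apply: le_trans.
rewrite mulrC; apply: ler_wpM2l => //.
by rewrite (le_trans (lerD (ler_norm C) (ler_norm D)))// lerDl.
Qed.
End Extension.

Lemma basis_isomorphism (R : realType) (X Y : completeNormedModType R)
    (B : set X) (C : set Y) (K L : R) (h : X -> Y) (k : Y -> X) :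
  suppression_basis K setT B -> suppression_basis L setT C ->
  (forall b, B b -> C (h b)) -> (forall c, C c -> B (k c)) ->
  (forall b, B b -> k (h b) = b) -> (forall c, C c -> h (k c) = c) ->
  dominates B id h -> dominates B h id ->
  B_isomorphic setT B setT C.
Proof.
move=> bB bC hB kC kh hk dh dk.
have dk' : dominates C id k.
  have k_inj c c' : C c -> C c' -> k c = k c' -> c = c'.
    by move=> Cc Cc' kcc'; rewrite -(hk c)// -(hk c')// kcc'.
  by apply: eq_dominates (dominates_reindex kC k_inj dk) => // c /hk.
have [T [Tl Tc Th]] := basis_operator bB dh.
have [S [Sl Sc Sk]] := basis_operator bC dk'.
have cT := (continuous_subspace_setT T).2 Tc.
have cS := (continuous_subspace_setT S).2 Sc.
exists T, S; split.
- by split => // _ [b Bb <-]; rewrite Th//; exact: hB.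
- by split => // _ [c Cc <-]; rewrite Sk//; exact: kC.
- move=> x _; apply: (@operator_eq_on_basis _ _ _ _ _ bB (S \o T) id) => //=.
  + by move=> a u v _ _; rewrite /= Tl// Sl.
  + apply: continuous_subspaceT => u.
    exact: (continuous_comp (cT u) (cS (T u))).
  + by apply: continuous_subspaceT => u; exact: cvg_id.
  + by move=> b Bb; rewrite Th// Sk ?kh//; exact: hB.
- move=> x _; apply: (@operator_eq_on_basis _ _ _ _ _ bC (T \o S) id) => //=.
  + by move=> a u v _ _; rewrite /= Sl// Tl.
  + apply: continuous_subspaceT => u.
    exact: (continuous_comp (cS u) (cT (S u))).
  + by apply: continuous_subspaceT => u; exact: cvg_id.
  + by move=> b Bb; rewrite Sk// Th ?hk//; exact: kC.
Qed.

Section CantorBernstein.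
Variables (X Y : Type) (B : set X) (C : set Y) (f : X -> Y) (g : Y -> X).

(** The elements of [B] whose backward orbit under [g], [f], [g], ... ends in
    [B] outside the image of [g]. The Cantor-Bernstein bijection is [f] on
    them and the inverse of [g] on the other elements of [B]. *)
Inductive cb_chain : X -> Prop :=
| cb_start b : B b -> ~ (g @` C) b -> cb_chain b
| cb_next b : cb_chain b -> cb_chain (g (f b)).
End CantorBernstein.

Section BasedCantorBernstein.
Variables (R : realType) (X Y : completeNormedModType R) (B : set X) (C : set Y).
Variables (K L : R) (f : X -> Y) (g : Y -> X).
Hypotheses (bB : suppression_basis K setT B) (bC : suppression_basis L setT C).
Hypotheses (fB : forall b, B b -> C (f b)) (gC : forall c, C c -> B (g c)).
Hypotheses (f_bnd : dominates B id f) (f_below : dominates B f id).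
Hypotheses (g_bnd : dominates C id g) (g_below : dominates C g id).

(** The Cantor-Bernstein bijection and its inverse are both bounded on the two
    pieces from which they are glued, because [f] and [g] are bounded above
    and below there; [dominatesU] bounds them on the whole basis. *)
Theorem based_cantor_bernstein : B_isomorphic setT B setT C.
Proof.
have f_inj := dominates_inj f_below; have g_inj := dominates_inj g_below.
pose A := cb_chain B C f g.
have AB b : A b -> B b by elim=> // {}b _ Bb; exact/gC/fB.
pose kA c := xget 0 [set b | A b /\ f b = c].
have kAE b : A b -> kA (f b) = b.
  move=> Ab; rewrite /kA; case: xgetP => [b' -> [/= Ab' fb']|/(_ b)[]//].
  exact: (f_inj _ _ (AB _ Ab') (AB _ Ab) fb').
pose gV b := xget 0 [set c | C c /\ g c = b].
have gVE c : C c -> gV (g c) = c.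
  move=> Cc; rewrite /gV; case: xgetP => [c' -> [/= Cc' gc']|/(_ c)[]//].
  exact: (g_inj _ _ Cc' Cc gc').
have nA b : B b -> ~ A b -> C (gV b) /\ g (gV b) = b.
  move=> Bb nAb; have [c Cc gc] : (g @` C) b.
    by apply: contrapT => nb; apply: nAb; exact: cb_start.
  by rewrite -gc gVE.
pose h b := if `[< A b >] then f b else gV b.
pose k c := if `[< exists2 b, A b & f b = c >] then kA c else g c.
have hA b : A b -> h b = f b by move=> Ab; rewrite /h asboolT.
have hnA b : ~ A b -> h b = gV b by move=> nAb; rewrite /h asboolF.
have hB b : B b -> C (h b).
  move=> Bb; have [Ab|nAb] := pselect (A b); first by rewrite hA//; exact: fB.
  by rewrite hnA//; have [] := nA b Bb nAb.
have kh b : B b -> k (h b) = b.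
  move=> Bb; have [Ab|nAb] := pselect (A b).
    by rewrite hA// /k asboolT ?kAE//; exists b.
  have [Cb gb] := nA b Bb nAb.
  rewrite hnA// /k asboolF// => -[b' Ab' fb']; apply: nAb.
  by rewrite -gb -fb'; exact: cb_next.
have kC c : C c -> B (k c).
  move=> Cc; rewrite /k; case: asboolP => [[b Ab <-]|_]; last exact: gC.
  by rewrite kAE//; exact: AB.
have hk c : C c -> h (k c) = c.
  move=> Cc; rewrite /k; case: asboolP => [[b Ab <-]|nc]; first by rewrite kAE ?hA.
  rewrite hnA ?gVE// => Agc; apply: nc.
  suff : forall b, A b -> b = g c -> exists2 b', A b' & f b' = c by move=> /(_ _ Agc erefl).
  move=> _ [b Bb gb bc|b Ab bc]; first by case: gb; exists c.
  by exists b => //; apply: g_inj bc => //; exact/fB/AB.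
have h_inj b b' : B b -> B b' -> h b = h b' -> b = b'.
  by move=> Bb Bb' hbb'; rewrite -(kh b)// -(kh b')// hbb'.
have BE : B = A `|` (B `\` A).
  by apply/seteqP; split => [b Bb|b [/AB//|[]//]]; have [?|?] := pselect (A b); [left|right].
have sB : suppressive (A `|` (B `\` A)) id K by rewrite -BE; exact: suppressive_id.
have sC : suppressive (A `|` (B `\` A)) h L.
  by rewrite -BE; exact: (suppressive_basis bC).
have gh b : (B `\` A) b -> C (h b) by move=> [/hB].
have gh_inj b b' : (B `\` A) b -> (B `\` A) b' -> h b = h b' -> b = b'.
  by move=> [Bb _] [Bb' _]; exact: h_inj.
have ghE b : (B `\` A) b -> g (h b) = b.
  by move=> [Bb nAb]; rewrite hnA//; have [] := nA b Bb nAb.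
apply: (basis_isomorphism bB bC hB kC kh hk).
- rewrite BE; apply: (dominatesU sB).
    by apply: eq_dominates (sub_dominates AB f_bnd) => // b /hA.
  by apply: eq_dominates (dominates_reindex gh gh_inj g_below) => // b /ghE.
- rewrite BE; apply: (dominatesU sC).
    by apply: eq_dominates (sub_dominates AB f_below) => // b /hA.
  by apply: eq_dominates (dominates_reindex gh gh_inj g_bnd) => // b /ghE.
Qed.
End BasedCantorBernstein.

(** * Gauges of polytopes *)

Section Gauge.
Variables (R : realType) (m n : nat) (M : 'M[R]_(m, n)).

Definition l1norm (l : 'rV[R]_m) : R := \sum_(i < m) `|l 0 i|.

(** The Minkowski gauge of the absolutely convex hull of the rows of [M],
    obtained as the quotient of the [l1] norm under [l |-> l *m M]. *)
Definition gauge (x : 'rV[R]_n) : R := inf (l1norm @` [set l | l *m M = x]).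

Lemma l1norm_ge0 l : 0 <= l1norm l.
Proof. by apply: sumr_ge0. Qed.

Lemma l1normD l1 l2 : l1norm (l1 + l2) <= l1norm l1 + l1norm l2.
Proof. by rewrite -big_split/=; apply: ler_sum => i _; rewrite mxE ler_normD. Qed.

Lemma l1normZ (a : R) l : l1norm (a *: l) = `|a| * l1norm l.
Proof. by rewrite mulr_sumr; apply: eq_bigr => i _; rewrite mxE normrM. Qed.

Lemma l1norm_delta i : l1norm (delta_mx 0 i) = 1.
Proof.
rewrite /l1norm (bigD1 i)//= big1 ?addr0 ?mxE ?eqxx ?normr1// => j ji.
by rewrite mxE (negPf ji) andbF normr0.
Qed.

Lemma l1norm_continuous : continuous l1norm.
Proof.
rewrite (_ : l1norm = fun l : 'rV[R]_m => \sum_(i < m) `|l 0 i|)//.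
apply: continuous_big => [|i _]; first exact: add_continuous.
by move=> l; apply: continuous_comp; [exact: coord_continuous|exact: norm_continuous].
Qed.

Lemma gauge_le_l1norm l : gauge (l *m M) <= l1norm l.
Proof.
apply: ge_inf; last by exists l.
by exists 0 => _ [k _ <-]; exact: l1norm_ge0.
Qed.

Lemma closed_representations (x : 'rV[R]_n) :
  closed [set l : 'rV[R]_m | l *m M = x].
Proof.
rewrite (_ : [set _ | _] = \bigcap_(j in setT)
    ((fun l : 'rV[R]_m => \sum_(i < m) l 0 i * M i j) @^-1` [set x 0 j])); last first.
  apply/seteqP; split => [l /= <- j _ /=|l lx]; first by rewrite mxE.
  by apply/rowP => j; rewrite mxE; exact: lx.
apply: closed_bigI => j _; apply: preimage_closed; last exact: closed_eq.
move=> l _; apply: continuous_big; first exact: add_continuous.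
by move=> i _ l'; apply: continuousM; [exact: coord_continuous|exact: cst_continuous].
Qed.

Hypothesis M_full : forall x : 'rV[R]_n, exists l, l *m M = x.

(** Representations of larger [l1] norm than a given one can be discarded, and
    those that remain form a compact set. Attainment makes the closed unit
    ball of the gauge equal to the hull of the rows. *)
Lemma gauge_attained x : exists2 l, l *m M = x & gauge x = l1norm l.
Proof.
have [l0 l0x] := M_full x.
pose A := [set l : 'rV[R]_m | l *m M = x] `&` (l1norm @^-1` [set t | t <= l1norm l0]).
have A0 : A !=set0 by exists l0; split => //=.
have cA : compact A.
  apply: bounded_closed_compact.
    exists (l1norm l0); split; first exact: num_real.
    move=> t /ltW l0t l [_ /= ll0].
    rewrite /Num.norm/= mx_normrE; apply: bigmax_le.
      exact: le_trans (l1norm_ge0 _) l0t.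
    move=> [i j] _ /=; rewrite (ord1 i) (le_trans _ l0t)// (le_trans _ ll0)//.
    by rewrite /l1norm (bigD1 j)//= lerDl sumr_ge0.
  apply: closedI; first exact: closed_representations.
  by apply: preimage_closed; [move=> ? _; exact: l1norm_continuous|exact: closed_le].
have [|l] := compact_EVT_min A0 cA (f := l1norm).
  exact/continuous_subspaceT/l1norm_continuous.
rewrite inE => -[/= lx ll0] lmin; exists l => //; apply/eqP; rewrite eq_le.
rewrite -{1}lx gauge_le_l1norm/=; apply: lb_le_inf; first by exists (l1norm l); exists l.
move=> _ [k /= kx <-]; have [kl0|/ltW l0k] := leP (l1norm k) (l1norm l0).
  by apply: lmin; rewrite inE; split.
exact: le_trans ll0 l0k.
Qed.

Lemma gaugeD x y : gauge (x + y) <= gauge x + gauge y.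
Proof.
have [l <- ->] := gauge_attained x; have [k <- ->] := gauge_attained y.
by rewrite -mulmxDl (le_trans (gauge_le_l1norm _))// l1normD.
Qed.

Lemma gaugeZ_le (a : R) x : gauge (a *: x) <= `|a| * gauge x.
Proof.
have [l <- ->] := gauge_attained x.
by rewrite scalemxAl -l1normZ gauge_le_l1norm.
Qed.

Lemma gaugeZ (a : R) x : gauge (a *: x) = `|a| * gauge x.
Proof.
apply/eqP; rewrite eq_le gaugeZ_le/=; have [->|a0] := eqVneq a 0.
  have [l _ ->] := gauge_attained (0 *: x); by rewrite normr0 mul0r l1norm_ge0.
rewrite -[x in leLHS](scalerK a0) mulrC -ler_pdivlMr ?normr_gt0//.
by rewrite mulrC -normfV gaugeZ_le.
Qed.

(** The gauge is the largest seminorm that is at most 1 on the rows: a seminorm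
    is compared with it by testing the rows. *)
Lemma le_gauge (q : 'rV[R]_n -> R) :
  (forall x y, q (x + y) <= q x + q y) ->
  (forall (a : R) x, q (a *: x) <= `|a| * q x) ->
  (forall i, q (row i M) <= 1) -> forall x, q x <= gauge x.
Proof.
move=> qD qZ qM x; have [l <- ->] := gauge_attained x.
have q0 : q 0 <= 0 by rewrite -(scale0r 0) (le_trans (qZ _ _))// normr0 mul0r.
rewrite mulmx_sum_row /l1norm; elim/big_ind2 : _ => //.
- by move=> a c b d ac bd; rewrite (le_trans (qD _ _))// lerD.
- by move=> i _; rewrite (le_trans (qZ _ _))// ler_piMr.
Qed.

Lemma gauge_row i : gauge (row i M) <= 1.
Proof. by rewrite rowE -(l1norm_delta i) gauge_le_l1norm. Qed.

End Gauge.

(** A positive combination is its total weight times a point of [C]; the weight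
    missing from 1 is put on the point 0. *)
Lemma conv_comb_in (R : realType) (V : lmodType R) (C : set V) (I : Type) (s : seq I)
    (l : I -> R) (v : I -> V) :
  convex_set (C : set (convex_lmodType V)) -> C 0 -> (forall i, C (v i)) ->
  (forall i, 0 <= l i) ->
  \sum_(i <- s) l i <= 1 -> C (\sum_(i <- s) l i *: v i).
Proof.
move=> cC C0 Cv l0 ls1.
have cC' x y (t : R) : C x -> C y -> 0 <= t -> t <= 1 -> C (t *: x + (1 - t) *: y).
  move=> Cx Cy t0 t1; have t01 : Itv.spec (@Itv.num_sem R) (Itv.Real `[0%Z, 1%Z]) t.
    by rewrite /Itv.num_sem/= realE t0/= in_itv/= t0 t1.
  have := cC x y (Itv.mk t01); rewrite !inE => /(_ Cx Cy); exact.
have s0 (r : seq I) : 0 <= \sum_(i <- r) l i by exact: sumr_ge0.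
have [c Cc ->] : exists2 c, C c & \sum_(i <- s) l i *: v i = (\sum_(i <- s) l i) *: c.
  elim: s {ls1} => [|i s [c Cc ih]]; first by exists 0; rewrite // !big_nil scale0r.
  rewrite !big_cons ih; have [t0|t0] := eqVneq (l i + \sum_(j <- s) l j) 0.
    exists 0 => //; rewrite t0 scale0r; move/eqP: t0; rewrite paddr_eq0//.
    by case/andP => /eqP -> /eqP ->; rewrite !scale0r addr0.
  set t := l i + _ in t0 *; exists (l i / t *: v i + (1 - l i / t) *: c).
    apply: cC' => //; first by rewrite divr_ge0// addr_ge0.
    rewrite ler_pdivrMr ?mul1r ?lerDl// lt_neqAle eq_sym t0.
    by rewrite addr_ge0.
  rewrite scalerDr !scalerA mulrBr mulr1 mulrC divfK//; congr (_ + _ *: _).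
  by rewrite /t addrAC subrr add0r.
have := cC' c 0 _ Cc C0 (s0 s) ls1; by rewrite scaler0 addr0.
Qed.

(** * Row vectors with an arbitrary norm *)

(** The bound on the coordinates gives definiteness, and also completeness
    through the comparison with the sup norm. *)
Record row_norm (R : realType) (n : nat) := RowNorm {
  row_norm_fun :> 'rV[R]_n -> R;
  row_normD : forall x y, row_norm_fun (x + y) <= row_norm_fun x + row_norm_fun y;
  row_normZ : forall (l : R) x, row_norm_fun (l *: x) = `|l| * row_norm_fun x;
  row_norm_coord : forall (x : 'rV[R]_n) i, `|x 0 i| <= row_norm_fun x }.

Section Renormed.
Variables (R : realType) (n : nat) (N : row_norm R n).

(** The row vectors, as a type of its own: ['rV[R]_n] already carries the sup
    norm. *)
Definition renormed (N : row_norm R n) : Type := 'rV[R]_n.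

Lemma row_norm0_eq0 x : N x = 0 -> x = 0.
Proof.
move=> Nx0; apply/rowP => i; rewrite mxE; apply/eqP.
by rewrite -normr_le0 -Nx0 row_norm_coord.
Qed.

HB.instance Definition _ := GRing.Lmodule.copy (renormed N) 'rV[R]_n.
HB.instance Definition _ := Lmodule_isNormed.Build R (renormed N)
  (@row_normD _ _ N) (@row_normZ _ _ N) row_norm0_eq0.

Lemma renormedE (x : renormed N) : `|x| = N x. Proof. by []. Qed.

Lemma row_norm0 : N 0 = 0.
Proof. by rewrite -[0](scale0r 0) row_normZ normr0 mul0r. Qed.

Lemma row_norm_sum_delta (x : 'rV[R]_n) :
  N x <= \sum_(i < n) `|x 0 i| * N (delta_mx 0 i).
Proof.
rewrite {1}[x]row_sum_delta.
elim/big_ind2 : _ => //; first by rewrite row_norm0.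
- by move=> a c b d ac bd; rewrite (le_trans (row_normD _ _ _))// lerD.
- by move=> i _; rewrite row_normZ.
Qed.

Lemma mx_norm_le_row_norm (x : 'rV[R]_n) : `|x| <= N x.
Proof.
have N0 : 0 <= N x by rewrite -(renormedE x).
rewrite {1}/Num.norm/= mx_normrE; apply: bigmax_le => //= -[i j] _ /=.
by rewrite (ord1 i) row_norm_coord.
Qed.

Lemma le_mx_norm (x : 'rV[R]_n) i : `|x 0 i| <= `|x|.
Proof.
rewrite [in leRHS]/Num.norm/= mx_normrE.
by apply/bigmax_geP; right => /=; exists (0, i).
Qed.

Lemma row_norm_le_mx_norm (x : 'rV[R]_n) :
  N x <= (\sum_(i < n) N (delta_mx 0 i)) * `|x|.
Proof.
apply: (le_trans (row_norm_sum_delta x)); rewrite mulr_suml.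
apply: ler_sum => i _; rewrite mulrC ler_wpM2l ?le_mx_norm//.
by rewrite -(renormedE (delta_mx 0 i)).
Qed.

Lemma renormed_complete (F : set_system (renormed N)) :
  ProperFilter F -> cauchy F -> cvg F.
Proof.
move=> FF Fc.
have Fc' : cauchy (F : set_system 'rV[R]_n).
  apply/cauchy_exP => e e0.
  have [x Fx] := (cauchyP F).1 Fc _ e0; exists x; move: Fx; apply: filterS => y /=.
  rewrite -!ball_normE /ball_/=.
  exact/le_lt_trans/mx_norm_le_row_norm.
have /cvg_ex[/= l Fl] := @cauchy_cvg 'rV[R]_n _ FF Fc'.
apply/cvg_ex; exists (l : renormed N).
apply/cvgrPdist_lt => e e0.
set M := \sum_(i < n) N (delta_mx 0 i).
have M0 : 0 <= M.
  by apply: sumr_ge0 => i _; rewrite -(renormedE (delta_mx 0 i)).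
have e1 : 0 < e / (M + 1) by rewrite divr_gt0// ltr_wpDl.
have := (cvgrPdist_lt _ _).1 Fl _ e1; move=> /(_ _).
apply: filterS => x; rewrite ltr_pdivlMr ?ltr_wpDl// => lx.
rewrite renormedE (le_lt_trans (row_norm_le_mx_norm _))// (le_lt_trans _ lx)//.
by rewrite mulrC ler_wpM2l// lerDl.
Qed.
HB.instance Definition _ := Uniform_isComplete.Build (renormed N) renormed_complete.
End Renormed.

(** * Rational polyhedral spaces *)

(** Each condition on the vertex set [S] is responsible for one property of its
    gauge. The unit vectors make the gauge finite and at most 1 on the
    basis; the bound on coordinates makes it a norm, at least 1 on the basis;
    stability under restriction makes the basis 1-suppression; symmetry and
    [0 \in S] make the unit ball the plain convex hull of [S], a rational
    polytope since the coordinates of the vertices are rational. *)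
Section PolyhedralSpace.
Variables (R : realType) (n : nat) (S : {fset 'rV[R]_n}).

Definition restrict_row (J : pred 'I_n) (x : 'rV[R]_n) : 'rV[R]_n :=
  \row_i (if J i then x 0 i else 0).

Hypothesis S_delta : forall i, delta_mx 0 i \in S.
Hypothesis S0 : 0 \in S.
Hypothesis S_opp : forall s, s \in S -> - s \in S.
Hypothesis S_coord : forall s i, s \in S -> `|s 0 i| <= 1.
Hypothesis S_rat : forall s i, s \in S -> exists q : rat, s 0 i = ratr q.
Hypothesis S_restrict : forall J s, s \in S -> restrict_row J s \in S.

Definition vertex_mx : 'M[R]_(size S, n) := \matrix_(k < size S) S`_k.

Lemma row_vertex_mx k : row k vertex_mx = S`_k.
Proof. by rewrite rowK. Qed.

Lemma vertex_row s : s \in S -> exists k, s = row k vertex_mx.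
Proof.
move=> sS; have ks : (index s S < size S)%N by rewrite index_mem.
by exists (Ordinal ks); rewrite rowK nth_index.
Qed.

Lemma row_vertex_in k : row k vertex_mx \in S.
Proof. by rewrite row_vertex_mx mem_nth. Qed.

Lemma vertex_full (x : 'rV[R]_n) : exists l, l *m vertex_mx = x.
Proof.
have [k kE] := choice (fun i => vertex_row (S_delta i)).
exists (\sum_i x 0 i *: delta_mx 0 (k i)).
rewrite mulmx_suml [RHS]row_sum_delta; apply: eq_bigr => i _.
by rewrite -scalemxAl -rowE -kE.
Qed.

Lemma gauge_vertex_le1 s : s \in S -> gauge vertex_mx s <= 1.
Proof. by move=> /vertex_row[k ->]; exact: gauge_row. Qed.

Lemma le_gauge_vertex (q : 'rV[R]_n -> R) :
  (forall x y, q (x + y) <= q x + q y) ->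
  (forall (a : R) x, q (a *: x) <= `|a| * q x) ->
  (forall s, s \in S -> q s <= 1) -> forall x, q x <= gauge vertex_mx x.
Proof.
move=> qD qZ qS; apply: le_gauge => //; first exact: vertex_full.
by move=> k; apply: qS; exact: row_vertex_in.
Qed.

Lemma coord_le_gauge (x : 'rV[R]_n) i : `|x 0 i| <= gauge vertex_mx x.
Proof.
apply: (@le_gauge_vertex (fun x : 'rV[R]_n => `|x 0 i|)).
- by move=> y z; rewrite mxE ler_normD.
- by move=> a y; rewrite mxE normrM.
- by move=> s; exact: S_coord.
Qed.

Definition gauge_norm : row_norm R n :=
  RowNorm (gaugeD vertex_full) (gaugeZ vertex_full) coord_le_gauge.

Notation A := (renormed gauge_norm).

Lemma restrict_rowD J x y :
  restrict_row J (x + y) = restrict_row J x + restrict_row J y.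
Proof. by apply/rowP => i; rewrite !mxE; case: ifP; rewrite ?addr0. Qed.

Lemma restrict_rowZ J (a : R) x : restrict_row J (a *: x) = a *: restrict_row J x.
Proof. by apply/rowP => i; rewrite !mxE; case: ifP; rewrite ?mulr0. Qed.

(** Restriction to [J] maps vertices to vertices. *)
Lemma gauge_restrict J x : gauge vertex_mx (restrict_row J x) <= gauge vertex_mx x.
Proof.
apply: (@le_gauge_vertex (fun x => gauge vertex_mx (restrict_row J x))).
- by move=> y z; rewrite restrict_rowD (gaugeD vertex_full).
- by move=> a y; rewrite restrict_rowZ (gaugeZ vertex_full).
- by move=> s sS; apply: gauge_vertex_le1; exact: S_restrict.
Qed.

Lemma gauge_delta i : gauge vertex_mx (delta_mx 0 i) = 1.
Proof.
apply/eqP; rewrite eq_le gauge_vertex_le1//=.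
by rewrite (le_trans _ (coord_le_gauge _ i))// mxE !eqxx normr1.
Qed.

Definition coord_subspace (J : pred 'I_n) : set A :=
  [set x : A | forall i, ~~ J i -> (x : 'rV[R]_n) 0 i = 0].
Definition coord_basis (J : pred 'I_n) : set A :=
  [set (delta_mx 0 i : A) | i in [set i | J i]].

Lemma delta_inj : injective (fun i : 'I_n => delta_mx 0 i : 'rV[R]_n).
Proof.
move=> i j /(congr1 (fun x : 'rV[R]_n => x 0 j)); rewrite !mxE !eqxx /=.
by case: eqVneq => // _ /eqP; rewrite eq_sym oner_eq0.
Qed.

Lemma sum_coord_basis J (F : {fset A}) (c : A -> R) : [set` F] `<=` coord_basis J ->
  \sum_(b <- F) c b *: b =
  \row_i (if (delta_mx 0 i : A) \in F then c (delta_mx 0 i) else 0) :> 'rV[R]_n.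
Proof.
move=> FJ.
have FE : F = [fset (delta_mx 0 i : A) | i in [pred i | (delta_mx 0 i : A) \in F]]%fset.
  apply/fsetP => b; apply/idP/imfsetP => [bF|[i /= iF ->//]].
  by have [i _ bi] := FJ _ bF; exists i; rewrite ?bi// /in_mem/= bi.
rewrite [in LHS]FE big_imfset/=; last by move=> i j _ _; exact: delta_inj.
rewrite big_enum/= big_mkcond/= [RHS]row_sum_delta; apply: eq_bigr => i _.
rewrite mxE; change (i \in _) with ((delta_mx 0 i : A) \in F).
by case: ifP => _; rewrite ?scale0r.
Qed.

Lemma coord_subspace_sub J : submod_closed [in coord_subspace J].
Proof.
split; first by rewrite inE => i _; rewrite mxE.
by move=> a x y; rewrite !inE => xJ yJ i Ji; rewrite !mxE xJ// yJ// mulr0 addr0.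
Qed.

Lemma coordZD (a : R) (x y : A) i :
  (a *: x + y : 'rV[R]_n) 0 i = a * (x : 'rV[R]_n) 0 i + (y : 'rV[R]_n) 0 i.
Proof. by rewrite !mxE. Qed.

Lemma coord_continuous_renormed i : continuous (fun x : A => (x : 'rV[R]_n) 0 i).
Proof.
have lin : linear_on [set: A] (fun x : A => (x : 'rV[R]_n) 0 i : R^o).
  by move=> a x y _ _; rewrite coordZD.
apply/continuous_subspace_setT.
apply: (bounded_linear_on_continuous (submod_closed_setT _) lin (C := 1)).
by move=> x _; rewrite mul1r; exact: coord_le_gauge.
Qed.

Lemma coord_subspace_closed J : closed (coord_subspace J).
Proof.
rewrite (_ : coord_subspace J = \bigcap_(i in [set i | ~~ J i])
    ((fun x : A => (x : 'rV[R]_n) 0 i) @^-1` [set 0])) //.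
apply: closed_bigI => i _; apply: preimage_closed; last exact: closed_eq.
by move=> x _; exact: coord_continuous_renormed.
Qed.

Lemma renormed_le_sum (x : A) : `|x| <= \sum_(i < n) `|(x : 'rV[R]_n) 0 i|.
Proof.
apply: (le_trans (row_norm_sum_delta gauge_norm x)); apply: ler_sum => i _.
by rewrite [gauge_norm _]gauge_delta mulr1.
Qed.

Lemma coord_subspace_separable J : separable_set (coord_subspace J).
Proof.
pose rat_vec := (fun q : 'rV[rat]_n => (map_mx ratr q : 'rV[R]_n) : A) @` setT.
exists (rat_vec `&` coord_subspace J); split.
- apply: (sub_countable (B := rat_vec)).
    by apply: subset_card_le => x [].
  exact: sub_countable (card_image_le _ _) (countableP [set: 'rV[rat]_n]).
- by move=> x [].
move=> x xJ U /nbhs_ballP[e /= e0 eU].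
have d0 : 0 < e / n.+1%:R by rewrite divr_gt0.
have /choice[q qP] : forall i, exists q : rat,
    (~~ J i -> q = 0) /\ `|(x : 'rV[R]_n) 0 i - ratr q| <= e / n.+1%:R.
  move=> i; have [Ji|/negbTE Ji] := boolP (J i); last first.
    by exists 0; split => //; rewrite rmorph0 xJ ?Ji// subrr normr0 ltW.
  have xe : (x : 'rV[R]_n) 0 i < (x : 'rV[R]_n) 0 i + e / n.+1%:R.
    by rewrite ltrDl.
  have [q /itvP qx] := rat_in_itvoo xe.
  exists q; split => //; rewrite ler0_norm ?subr_le0 ?qx// opprB lerBlDl.
  by rewrite qx.
exists (map_mx ratr (\row_i q i)); split; first split.
- by exists (\row_i q i).
- by move=> i Ji; rewrite !mxE (proj1 (qP i))// rmorph0.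
apply: eU; rewrite -ball_normE /ball_/=.
rewrite (le_lt_trans (renormed_le_sum _))//.
rewrite (@le_lt_trans _ _ (\sum_(i < n) (e / n.+1%:R)))//.
  by apply: ler_sum => i _; rewrite !mxE; exact: (qP i).2.
by rewrite sumr_const card_ord -[ltLHS]mulr_natr mulrAC ltr_pdivrMr// ltr_pM2l// ltr_nat.
Qed.

Lemma polyhedral_K_based (K : R) J : 1 <= K ->
  K_based K (coord_subspace J) (coord_basis J).
Proof.
move=> K1; split => //.
  split; [exact: coord_subspace_sub|exact: coord_subspace_closed|].
  exact: coord_subspace_separable.
split.
  move=> _ [i /= Ji <-] j Jj; rewrite mxE/=; case: eqVneq => // ji.
  by rewrite ji Ji in Jj.
(* The dot product with a unit vector is a coordinate functional. *)
pose e (b x : A) : R^o := \sum_i (b : 'rV[R]_n) 0 i * (x : 'rV[R]_n) 0 i.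
have eE i x : e (delta_mx 0 i : A) x = (x : 'rV[R]_n) 0 i.
  rewrite /e (bigD1 i)//= mxE !eqxx mul1r big1 ?addr0// => j ji.
  by rewrite mxE (negbTE ji) mul0r.
have sumE (F : {fset A}) x : [set` F] `<=` coord_basis J ->
    \sum_(b <- F) e b x *: b =
    restrict_row [pred i | (delta_mx 0 i : A) \in F] x :> 'rV[R]_n.
  move=> /sum_coord_basis ->; apply/rowP => i.
  by rewrite !mxE /= eE.
exists e; split.
- move=> _ [i _ <-]; split.
    by move=> a x y _ _; rewrite !eE coordZD.
  rewrite (_ : e _ = fun x : A => (x : 'rV[R]_n) 0 i); last first.
    by apply/funext => x; rewrite eE.
  by apply: continuous_subspaceT; exact: coord_continuous_renormed.
- move=> _ [i _ <-]; split; first exact: gauge_delta.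
  by rewrite eE mxE !eqxx.
- move=> _ _ [i _ <-] [j _ <-] ij; rewrite eE mxE/=; case: eqVneq => // ji.
  by case: ij; rewrite ji.
- move=> x xJ eps eps0.
  exists [fset (delta_mx 0 i : A) | i in [pred i | J i]]%fset; split.
    by move=> b /= /imfsetP[i /= Ji ->]; exists i.
  move=> E FE EJ; rewrite sumE// (_ : restrict_row _ _ = x) ?subrr ?normr0//.
  apply/rowP => i; rewrite mxE /=; case: ifPn => // iE.
  rewrite xJ//; apply: contra iE => Ji; apply: FE => /=.
  by apply/imfsetP; exists i.
- move=> F FJ x _; rewrite sumE//.
  rewrite (@le_trans _ _ (gauge vertex_mx x))//; first exact: gauge_restrict.
  rewrite -[leLHS]mul1r; apply: ler_wpM2r => //; exact: (normr_ge0 (x : A)).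
Qed.

Lemma coord_subspaceT : coord_subspace predT = setT.
Proof. by apply/seteqP; split => // x _ i. Qed.

Lemma coord_based_subspace J :
  based_subspace (coord_subspace J) (coord_basis J) setT (coord_basis predT).
Proof.
split => //.
- by exists 1; exact: polyhedral_K_based.
- by exists 1; rewrite -coord_subspaceT; exact: polyhedral_K_based.
apply/seteqP; split => [_ [i /= Ji <-]|x [/= xJ [i _ ix]]].
  split; last by exists i.
  by move=> j Jj; rewrite mxE/=; case: eqVneq => // ji; rewrite ji Ji in Jj.
exists i => //=; apply: contraT => Ji; move: (xJ i Ji); rewrite -ix mxE !eqxx.
by move/eqP; rewrite oner_eq0.
Qed.

Definition full_basis : {fset A} := [fset (delta_mx 0 i : A) | i in 'I_n]%fset.

Lemma full_basis_sub : [set` full_basis] `<=` coord_basis predT.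
Proof. by move=> b /= /imfsetP[i /= _ ->]; exists i. Qed.

Lemma sum_full_basis (c : A -> R) :
  \sum_(b <- full_basis) c b *: b = \row_i c (delta_mx 0 i) :> 'rV[R]_n.
Proof.
rewrite (sum_coord_basis c full_basis_sub); apply/rowP => i.
by rewrite !mxE ifT//; apply/imfsetP; exists i.
Qed.

Lemma polyhedral_finite_dimensional : finite_dimensional [set: A].
Proof.
exists full_basis; split => // x _.
exists (fun b : A => \sum_i (b : 'rV[R]_n) 0 i * (x : 'rV[R]_n) 0 i).
rewrite sum_full_basis; apply/rowP => i; rewrite mxE.
rewrite (bigD1 i)//= mxE !eqxx mul1r big1 ?addr0// => j ji.
by rewrite mxE (negbTE ji) mul0r.
Qed.

(** A vector of gauge at most 1 is, by attainment, a combination of vertices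
    with [l1] norm at most 1; by symmetry the signs of the coefficients can
    be moved to the vertices. *)
Lemma polyhedral_rational : fd_rational [set: A] (coord_basis predT).
Proof.
exists (S : {fset A}); split.
  move=> s /= sS; have /choice[q qE] := fun i => S_rat i sS.
  exists full_basis.
  exists (fun b => \sum_i (if b == (delta_mx 0 i : A) then q i else 0)).
  split; first exact: full_basis_sub.
  rewrite sum_full_basis; apply/rowP => i; rewrite mxE qE.
  rewrite (bigD1 i)//= eqxx big1 ?addr0// => j ji.
  case: eqP => // /delta_inj ij; by rewrite ij eqxx in ji.
rewrite setTI; apply/seteqP; split; last first.
  apply: smallest_sub => [|s /= sS]; last exact: gauge_vertex_le1.
  move=> x y t; rewrite !inE /= => x1 y1.
  rewrite (le_trans (ler_normD _ _))// !normrZ.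
  rewrite ger0_norm// ger0_norm ?subr_ge0//.
  rewrite (@le_trans _ _ (t%:num + (1 - t%:num)))//.
    by rewrite lerD// ler_piMr// subr_ge0.
  by rewrite addrC subrK.
move=> x /= x1 C [cC SC].
have [l lx gl] := gauge_attained vertex_full x.
have l1 : l1norm l <= 1 by rewrite -gl.
pose v k : A := if 0 <= l 0 k then row k vertex_mx else - row k vertex_mx.
have -> : x = \sum_k `|l 0 k| *: v k.
  rewrite -lx mulmx_sum_row; apply: eq_bigr => k _; rewrite /v.
  by case: ger0P => _ //; rewrite scalerN scaleNr opprK.
apply: conv_comb_in => //; first exact: SC.
by move=> k; apply: SC; rewrite /v /=; case: ifP => _; [|apply: S_opp]; exact: row_vertex_in.
Qed.
End PolyhedralSpace.

(** * The grid norm of a sequence of vectors *)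

(** To a sequence [b] of vectors of norm at most 1 corresponds a norm on each
    ['rV[R]_n], polyhedral with rational vertices. It is at least the norm of
    the sum of the [x 0 i *: b i], and, whatever [n], at most three times the
    largest of the absolute values of the coordinates and the norms of the
    partial sums. *)
Section Grid.
Variables (R : realType) (U : normedModType R) (b : nat -> U).
Hypothesis b_le1 : forall i, `|b i| <= 1.

(** The mesh of the [i]-th coordinate. It does not depend on the dimension,
    which makes the norms of different dimensions compatible, and the meshes
    sum to at most 1/2, which bounds the total effect of rounding. *)
Definition mesh (i : nat) : R := (2 ^+ i.+2)^-1.

Lemma mesh_gt0 i : 0 < mesh i.
Proof. by rewrite invr_gt0 exprn_gt0. Qed.

Lemma sum_mesh n : \sum_(i < n) mesh i <= 2^-1.
Proof.
suff -> : \sum_(i < n) mesh i = 2^-1 - (2 ^+ n.+1)^-1.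
  by rewrite lerBlDr lerDl invr_ge0 exprn_ge0.
elim: n => [|n ih]; first by rewrite big_ord0 expr1 subrr.
rewrite big_ord_recr/= ih /mesh !exprS; field.
by rewrite expf_neq0.
Qed.

(** The last condition keeps the gauge above the norm of the sum of the
    [x 0 i *: b i]; it bears on all sets [J] of indices in order to be stable
    under restriction. The second condition keeps the set finite at indices
    where [b i] vanishes. *)
Definition grid_vertex n (x : 'rV[R]_n) : Prop :=
  [/\ forall i, exists k : int, x 0 i = k%:~R * mesh i,
      forall i, `|x 0 i| <= 1
    & forall J : pred nat, `|\sum_(i < n | J i) x 0 i *: b i| <= 1].

(** A vertex has coordinates [k * mesh i] with [k] an integer between [- W]
    and [W]. *)
Lemma finite_grid n : finite_set [set x : 'rV[R]_n | grid_vertex x].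
Proof.
pose W := (2 ^ n.+2)%N.
pose h (k : {ffun 'I_n -> 'I_(W + W).+1}) : 'rV[R]_n :=
  \row_i (((k i)%:Z - W%:Z)%:~R * mesh i).
apply: (sub_finite_set (B := h @` setT)); last exact: finite_image.
move=> x [/= xk x1 _]; have [k kE] := choice xk.
have kW i : - W%:Z <= k i <= W%:Z.
  rewrite -ler_norml -(ler_int R) intr_norm.
  have := x1 i; rewrite kE normrM (gtr0_norm (mesh_gt0 _)) ler_pdivrMr ?exprn_gt0//.
  rewrite mul1r => /le_trans; apply; rewrite /W -[leRHS]/((2 ^ n.+2)%N%:R) natrX.
  by rewrite ler_eXn2l// ?ltr1n// !ltnS ltnW.
have kW0 i : 0 <= k i + W%:Z by have /andP[] := kW i; rewrite -lerBlDr sub0r.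
exists [ffun i => inord (absz (k i + W%:Z))] => //.
apply/rowP => i; rewrite mxE ffunE inordK; last first.
  rewrite ltnS -lez_nat gez0_abs// PoszD lerD2r.
  by have /andP[] := kW i.
by rewrite gez0_abs// addrK kE.
Qed.

Definition grid_vertices n : {fset 'rV[R]_n} :=
  fset_set [set x : 'rV[R]_n | grid_vertex x].

Lemma grid_verticesP n (x : 'rV[R]_n) : reflect (grid_vertex x) (x \in grid_vertices n).
Proof.
rewrite /grid_vertices in_fset_set; last exact: finite_grid.
by apply: (iffP idP); rewrite inE.
Qed.

Lemma grid_delta n i : delta_mx 0 i \in grid_vertices n.
Proof.
apply/grid_verticesP; split => [j|j|J].
- rewrite mxE/=; case: eqVneq => [_|_]; last by exists 0; rewrite mul0r.
  exists (2 ^+ j.+2); rewrite rmorphXn/= /mesh mulfV// expf_neq0.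
- by rewrite mxE/=; case: (j == i); rewrite ?normr1 ?normr0.
rewrite big_mkcond (bigD1 i)//= big1 ?addr0 => [|j ji].
  by case: ifP => _; rewrite ?normr0// mxE !eqxx scale1r.
by rewrite mxE (negbTE ji) scale0r if_same.
Qed.

Lemma grid_0 n : 0 \in grid_vertices n.
Proof.
apply/grid_verticesP; split => [j|j|J].
- by exists 0; rewrite mxE mul0r.
- by rewrite mxE normr0.
- by rewrite big1 ?normr0// => j _; rewrite mxE scale0r.
Qed.

Lemma grid_opp n s : s \in grid_vertices n -> - s \in grid_vertices n.
Proof.
move=> /grid_verticesP[sk s1 sJ]; apply/grid_verticesP; split => [j|j|J].
- by have [k kE] := sk j; exists (- k); rewrite mxE kE mulrNz mulNr.
- by rewrite mxE normrN.
- under eq_bigr do rewrite mxE scaleNr; by rewrite sumrN normrN.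
Qed.

Lemma grid_coord n (s : 'rV[R]_n) i : s \in grid_vertices n -> `|s 0 i| <= 1.
Proof. by move=> /grid_verticesP[]. Qed.

Lemma grid_rat n (s : 'rV[R]_n) i :
  s \in grid_vertices n -> exists q : rat, s 0 i = ratr q.
Proof.
move=> /grid_verticesP[/(_ i)[k ->] _ _]; exists (k%:~R * (2 ^+ i.+2)^-1).
by rewrite rmorphM/= fmorphV/= rmorphXn/= ratr_int ratr_nat.
Qed.

Lemma grid_restrict n J (s : 'rV[R]_n) :
  s \in grid_vertices n -> restrict_row J s \in grid_vertices n.
Proof.
move=> /grid_verticesP[sk s1 sJ]; apply/grid_verticesP; split => [j|j|J'].
- rewrite mxE; case: ifP => _; first exact: sk.
  by exists 0; rewrite mul0r.
- by rewrite mxE; case: ifP; rewrite ?normr0.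
have := sJ [pred i | J' i && oapp J false (insub i)].
rewrite big_mkcondr/=; congr (`|_| <= _); apply: eq_bigr => i _.
by rewrite mxE valK/=; case: ifP; rewrite ?scale0r.
Qed.

Definition grid_norm n : row_norm R n :=
  gauge_norm (@grid_delta n) (@grid_coord n).

Lemma grid_normE n (x : 'rV[R]_n) : grid_norm n x = gauge (vertex_mx (grid_vertices n)) x.
Proof. by []. Qed.

Lemma grid_norm_le_sum n (x : 'rV[R]_n) : grid_norm n x <= \sum_(i < n) `|x 0 i|.
Proof. exact: (renormed_le_sum (x : renormed (grid_norm n))). Qed.

Lemma grid_norm_ge n (x : 'rV[R]_n) : `|\sum_(i < n) x 0 i *: b i| <= grid_norm n x.
Proof.
rewrite grid_normE; apply: (le_gauge_vertex (@grid_delta n)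
  (q := fun x : 'rV[R]_n => `|\sum_(i < n) x 0 i *: b i|)).
- move=> y z; under eq_bigr do rewrite mxE scalerDl.
  by rewrite big_split/= ler_normD.
- move=> a y; under eq_bigr do rewrite mxE -scalerA.
  by rewrite -scaler_sumr normrZ.
- by move=> s /grid_verticesP[_ _ /(_ predT)].
Qed.

(** Scaled by [1 / (2 * t)], the vector [x] has all the quantities in question
    at most 1/2. Rounding it down to the grid changes them by at most the sum
    of the meshes, so that the rounded vector is a vertex, of gauge at most 1,
    while the remainder has gauge at most its [l1] norm, that is 1/2. Hence the
    factor [2 * (1 + 1/2)]. *)
Lemma grid_norm_le n (x : 'rV[R]_n) t : 
  (forall i, `|x 0 i| <= t) ->
  (forall J : pred nat, `|\sum_(i < n | J i) x 0 i *: b i| <= t) ->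
  grid_norm n x <= 3 * t.
Proof.
move=> xt xJt.
have t_ge0 : 0 <= t by apply: le_trans (xJt predT).
have [t0|t0] := leP t 0.
  have -> : x = 0.
    by apply/rowP => i; rewrite mxE; apply/eqP; rewrite -normr_le0 (le_trans (xt i)).
  by rewrite row_norm0 mulr_ge0.
pose c : R := (2 * t)^-1.
have c0 : 0 < c by rewrite invr_gt0 mulr_gt0.
have ct : c * t = 2^-1 by rewrite /c; field; rewrite gt_eqF.
pose z : 'rV[R]_n := \row_i ((Num.floor (c * x 0 i / mesh i))%:~R * mesh i).
have zx i : `|c * x 0 i - z 0 i| <= mesh i.
  rewrite mxE; set y := c * x 0 i; have m0 := mesh_gt0 i.
  have -> : y - (Num.floor (y / mesh i))%:~R * mesh i =
    (y / mesh i - (Num.floor (y / mesh i))%:~R) * mesh i.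
    by rewrite mulrBl divfK ?gt_eqF.
  rewrite normrM (gtr0_norm m0) ler_piMl ?(ltW m0)// ger0_norm ?subr_ge0 ?floor_le//.
  by have := floorD1_gt (y / mesh i); rewrite lerBlDl intrD mulr1z => /ltW.
have m12 i : mesh i <= 2^-1.
  by rewrite /mesh lef_pV2 ?posrE ?exprn_gt0// -[leLHS]expr1 ler_eXn2l ?ltr1n.
have zS : z \in grid_vertices n.
  apply/grid_verticesP; split => [i|i|J].
  - by exists (Num.floor (c * x 0 i / mesh i)); rewrite mxE.
  - have -> : z 0 i = c * x 0 i - (c * x 0 i - z 0 i) by rewrite opprB addrC subrK.
    rewrite (le_trans (ler_normB _ _))// [leRHS](splitr 1) lerD//.
      by rewrite normrM gtr0_norm// mul1r -ct ler_pM2l.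
    by rewrite (le_trans (zx i))// mul1r.
  have -> : \sum_(i < n | J i) z 0 i *: b i =
      c *: (\sum_(i < n | J i) x 0 i *: b i) - \sum_(i < n | J i) (c * x 0 i - z 0 i) *: b i.
    rewrite scaler_sumr -sumrB; apply: eq_bigr => i _.
    by rewrite scalerA -scalerBl opprB addrC subrK.
  rewrite (le_trans (ler_normB _ _))// [leRHS](splitr 1) lerD//.
    by rewrite normrZ gtr0_norm// mul1r -ct ler_pM2l.
  rewrite mul1r (le_trans (ler_norm_sum _ _ _))// (le_trans _ (sum_mesh n))//.
  rewrite big_mkcond; apply: ler_sum => i _; case: ifP => _; last exact/ltW/mesh_gt0.
  by rewrite normrZ (le_trans (ler_piMr _ _)).
have -> : x = c^-1 *: (z + (c *: x - z)) by rewrite addrC subrK scalerA mulVf ?scale1r ?gt_eqF.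
rewrite row_normZ gtr0_norm ?invr_gt0 ?mulr_gt0//.
have -> : 3 * t = c^-1 * (1 + 2^-1) by rewrite /c; field; rewrite gt_eqF.
rewrite ler_pM2l ?invr_gt0 ?mulr_gt0//.
rewrite (le_trans (row_normD _ _ _))// lerD//.
  by rewrite grid_normE gauge_vertex_le1.
rewrite (le_trans (grid_norm_le_sum _))// (le_trans _ (sum_mesh n))//.
by apply: ler_sum => i _; have := zx i; rewrite !mxE.
Qed.

Definition trunc_row n (x : 'rV[R]_n.+1) : 'rV[R]_n :=
  \row_i x 0 (widen_ord (leqnSn n) i).
Definition pad_row n (x : 'rV[R]_n) : 'rV[R]_n.+1 :=
  \row_i oapp (x 0) 0 (insub (i : nat)).

Lemma pad_row_widen n (x : 'rV[R]_n) i : pad_row x 0 (widen_ord (leqnSn n) i) = x 0 i.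
Proof. by rewrite mxE/= valK. Qed.

Lemma pad_row_max n (x : 'rV[R]_n) : pad_row x 0 ord_max = 0.
Proof. by rewrite mxE/= insubF// ltnn. Qed.

Lemma pad_trunc n (x : 'rV[R]_n.+1) : x 0 ord_max = 0 -> pad_row (trunc_row x) = x.
Proof.
move=> x0; apply/rowP => i; rewrite mxE; case: insubP => [j _ ji|/=].
  by rewrite /= mxE; congr (x 0 _); apply: val_inj.
rewrite -leqNgt => ni; rewrite -x0; congr (x 0 _).
by apply/val_inj/eqP; rewrite eqn_leq ni -ltnS ltn_ord.
Qed.

Lemma grid_trunc n s : s \in grid_vertices n.+1 -> trunc_row s \in grid_vertices n.
Proof.
move=> /grid_verticesP[sk s1 sJ]; apply/grid_verticesP; split => [j|j|J].
- by rewrite mxE; exact: sk.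
- by rewrite mxE.
have := sJ [pred i | (i < n)%N && J i].
rewrite big_mkcond big_ord_recr/= ltnn addr0 -big_mkcond/=.
congr (`|_| <= _); apply: eq_big => [i|i _]; first by rewrite ltn_ord.
by rewrite mxE.
Qed.

Lemma grid_pad n s : s \in grid_vertices n -> pad_row s \in grid_vertices n.+1.
Proof.
move=> /grid_verticesP[sk s1 sJ]; apply/grid_verticesP; split => [j|j|J].
- rewrite mxE; case: insubP => [i _ <-|_]/=; first exact: sk.
  by exists 0; rewrite mul0r.
- by rewrite mxE; case: insubP => [i _ _|_]/=; rewrite ?normr0.
rewrite big_mkcond big_ord_recr/= pad_row_max scale0r if_same addr0 -big_mkcond/=.
have := sJ J; congr (`|_| <= _); apply: eq_bigr => i _.
by rewrite pad_row_widen.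
Qed.

(** Dropping or adding a last coordinate 0 maps vertices to vertices, hence
    neither operation increases the gauge. *)
Lemma grid_norm_trunc n (x : 'rV[R]_n.+1) : x 0 ord_max = 0 ->
  grid_norm n.+1 x = grid_norm n (trunc_row x).
Proof.
move=> x0; apply/eqP; rewrite eq_le; apply/andP; split; last first.
  rewrite [leRHS]grid_normE; apply: (le_gauge_vertex (@grid_delta n.+1)
    (q := fun x => grid_norm n (trunc_row x))).
  - move=> y z; have -> : trunc_row (y + z) = trunc_row y + trunc_row z.
      by apply/rowP => i; rewrite !mxE.
    exact: row_normD.
  - move=> a y; have -> : trunc_row (a *: y) = a *: trunc_row y.
      by apply/rowP => i; rewrite !mxE.
    by rewrite row_normZ.
  - by move=> s /grid_trunc; exact: gauge_vertex_le1.
rewrite -{1}(pad_trunc x0) [leRHS]grid_normE; apply: (le_gauge_vertex (@grid_delta n)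
    (q := fun x => grid_norm n.+1 (pad_row x))).
- move=> y z; have -> : pad_row (y + z) = pad_row y + pad_row z.
    by apply/rowP => i; rewrite !mxE; case: insub => [j|]/=; rewrite ?mxE ?addr0.
  exact: row_normD.
- move=> a y; have -> : pad_row (a *: y) = a *: pad_row y.
    by apply/rowP => i; rewrite !mxE; case: insub => [j|]/=; rewrite ?mxE ?mulr0.
  by rewrite row_normZ.
- by move=> s /grid_pad; exact: gauge_vertex_le1.
Qed.

End Grid.

(** * Isometric copies of grid norms in a universal space *)

Section RIChain.
Variables (R : realType) (K : R) (X : completeNormedModType R) (BX : set X).
Hypotheses (K1 : 1 <= K) (X_univ : RI_universal K setT BX).
Variables (U : normedModType R) (b : nat -> U).
Hypothesis b_le1 : forall i, `|b i| <= 1.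

Let N n : row_norm R n := grid_norm b_le1 n.

Definition copies (n : nat) (y : nat -> X) : Prop :=
  (forall i, (i < n)%N -> BX (y i)) /\
  forall x : 'rV[R]_n, `|\sum_(i < n) x 0 i *: y i| = N n x.

(** The universality of [X] is applied to ['rV[R]_n.+1] with its grid norm. The
    given vectors are the images of the first [n] unit vectors under an
    isometry morphism, by [grid_norm_trunc]; the image of the last unit vector
    under an extension is the new vector. *)
Lemma copies_step n (y : nat -> X) : copies n y ->
  exists2 z, BX z & forall x : 'rV[R]_n.+1,
    `|\sum_(i < n) x 0 (widen_ord (leqnSn n) i) *: y i + x 0 ord_max *: z| = N n.+1 x.
Proof.
move=> [By yN].
pose A : completeNormedModType R := renormed (N n.+1).
pose J : pred 'I_n.+1 := fun i => (i < n)%N.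
pose Lam : set A := coord_subspace J.
pose BLam : set A := coord_basis J.
pose BA : set A := coord_basis predT.
pose f (x : A) : X := \sum_(i < n) (x : 'rV[R]_n.+1) 0 (widen_ord (leqnSn n) i) *: y i.
have f_lin : linear_on Lam f.
  move=> a u v _ _; rewrite /f scaler_sumr -big_split/=; apply: eq_bigr => i _.
  by rewrite coordZD scalerDl scalerA.
have f_norm u : Lam u -> `|f u| = `|u|.
  move=> Lu; rewrite renormedE grid_norm_trunc; last by apply: Lu; rewrite /J /= ltnn.
  by rewrite -[RHS]yN; congr `|_|; apply: eq_bigr => i _; rewrite mxE.
have f_delta i : f (delta_mx 0 (widen_ord (leqnSn n) i) : A) = y i.
  rewrite /f (bigD1 i)//= mxE !eqxx scale1r big1 ?addr0// => j ji.
  by rewrite mxE/= -val_eqE/= val_eqE (negbTE ji) scale0r.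
have f_mor : isometry_morphism Lam BLam setT BX f.
  split => //; split => //.
    apply: (bounded_linear_on_continuous (@coord_subspace_sub _ _ _ _ _ J) f_lin (C := 1)).
    by move=> x Lx; rewrite mul1r f_norm.
  move=> _ [_ [i /= iJ <-] <-].
  have -> : i = widen_ord (leqnSn n) (Ordinal (iJ : (i < n)%N)) by apply: val_inj.
  by rewrite f_delta; exact: By.
have BA_K : K_based K setT BA.
  rewrite -coord_subspaceT; apply: polyhedral_K_based => //.
  exact: grid_restrict.
have BA_rat : fd_rational setT BA.
  by apply: polyhedral_rational; [exact: grid_0|exact: grid_opp|exact: grid_rat].
have BA_sub : based_subspace Lam BLam setT BA.
  by apply: coord_based_subspace; exact: grid_restrict.
have [g [[[g_lin _ _ g_B] g_norm] gf]] := @X_univ A BA Lam BLam f BA_K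
  (polyhedral_finite_dimensional _ _) BA_rat BA_sub f_mor.
exists (g (delta_mx 0 ord_max : A)).
  by apply: g_B; exists (delta_mx 0 ord_max) => //; exists ord_max.
move=> x; rewrite -[RHS](g_norm (x : A))//; congr `|_|.
have -> : g x = \sum_i x 0 i *: g (delta_mx 0 i : A).
  rewrite -(linear_on_sum (submod_closed_setT _) g_lin)//; congr (g _).
  exact: row_sum_delta.
rewrite big_ord_recr/=.
congr (_ + _); apply: eq_bigr => i _; rewrite gf ?f_delta// => j.
rewrite /J -leqNgt => nj; rewrite mxE/=; case: eqVneq => // ji.
by move: nj; rewrite ji /= leqNgt ltn_ord.
Qed.

Lemma copies_sequence : exists y : nat -> X, forall n, copies n y.
Proof.
(* The sequence is built as the union of its initial segments. *)
have step (s : seq X) : exists z, copies (size s) (nth 0 s) ->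
    copies (size s).+1 (nth 0 (rcons s z)).
  have [c|c] := pselect (copies (size s) (nth 0 s)); last by exists 0.
  have [z Bz zN] := copies_step c; exists z => _; split.
    move=> i; rewrite ltnS leq_eqVlt => /orP[/eqP ->|si].
      by rewrite nth_rcons ltnn eqxx.
    by rewrite nth_rcons si; exact: c.1.
  move=> x; rewrite -zN big_ord_recr/= nth_rcons ltnn eqxx; congr `|_ + _|.
  by apply: eq_bigr => i _; rewrite nth_rcons ltn_ord.
have [F FP] := choice step.
pose s n := iter n (fun s => rcons s (F s)) [::].
pose y n := F (s n).
have sE n : s n = mkseq y n by elim: n => [//|n ih]; rewrite mkseqS -ih.
have copy_eq n (u v : nat -> X) : (forall i, (i < n)%N -> u i = v i) -> copies n u -> copies n v.
  move=> uv [Bu uN]; split => [i ni|x]; first by rewrite -uv//; exact: Bu.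
  by rewrite -uN; congr `|_|; apply: eq_bigr => i _; rewrite uv.
exists y; elim=> [|n ih].
  split => // x; rewrite big_ord0 normr0.
  by rewrite (_ : x = 0) ?row_norm0//; apply/rowP => -[].
have := FP (s n); rewrite -/(y n) sE size_mkseq -mkseqS => H.
apply: (copy_eq n.+1 (nth 0 (mkseq y n.+1))).
  by move=> i ni; rewrite nth_mkseq.
apply: H.
by apply: (copy_eq n y) => // i ni; rewrite nth_mkseq.
Qed.

End RIChain.

(** * Embeddings in both directions *)

(** Distinct basis vectors are at distance at least [K^-1], so a dense set
    has a different point close to each of them. *)
Lemma basis_countable (R : realType) (X : completeNormedModType R) (B : set X) (K : R) :
  K_based K setT B -> countable B.
Proof.
move=> [K1 [_ _ [D [cD _ Ddense]]] bB].
have K0 : 0 < K by rewrite (lt_le_trans ltr01).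
have sep b b' : B b -> B b' -> b != b' -> 1 <= K * `|b - b'|.
  move=> Bb Bb' bb'; have [_ [e [_ e1 _ _ _]]] := bB.
  have := @suppressive_id _ _ _ _ bB [fset b; b']%fset
    (fun x => if x == b then 1 else -1) (pred1 b).
  rewrite big_mkcond !big_fsetU1 ?inE//= !big_seq_fset1 eqxx eq_sym (negbTE bb').
  rewrite addr0 scale1r scaleN1r (e1 b Bb).1; apply.
  by move=> x /=; rewrite !inE => /orP[] /eqP ->.
have e0 : 0 < (2 * K)^-1 by rewrite invr_gt0 mulr_gt0.
have /choice[d dP] : forall b, exists d, D d /\ `|b - d| < (2 * K)^-1.
  move=> b; have [d [Dd bd]] := Ddense b Logic.I _ (nbhsx_ballx b _ e0).
  by exists d; split => //; rewrite -ball_normE in bd.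
have /countable_injP[f f_inj] := cD; apply/countable_injP; exists (f \o d).
move=> b b'; rewrite !inE => Bb Bb' /=.
move=> /f_inj; rewrite !inE => /(_ (dP b).1 (dP b').1) dd.
apply: contrapT => /eqP /(sep _ _ Bb Bb'); apply/negP; rewrite -ltNge.
rewrite mulrC -ltr_pdivlMr// div1r (_ : b - b' = (b - d b) - (b' - d b')).
  rewrite (le_lt_trans (ler_normB _ _))// (lt_le_trans (ltrD (dP b).2 (dP b').2))//.
  rewrite (_ : _ + _ = K^-1)//; field; by rewrite gt_eqF.
by rewrite dd opprB addrA subrK.
Qed.

(** The basis of [U] is listed as a sequence in which unused indices carry the
    vector 0. The grid norm bounds from above the norm of finite sums of the
    listed vectors; since the basis is unconditional, it is also bounded by a
    multiple of it, and [X] contains a copy of the grid norm. *)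
Lemma RI_universal_embedding (R : realType) (K L : R) (X U : completeNormedModType R)
    (BX : set X) (B : set U) :
  1 <= K -> RI_universal K setT BX -> K_based L setT B ->
  exists f : U -> X, [/\ forall b, B b -> BX (f b),
    dominates B id f & dominates B f id].
Proof.
move=> K1 X_univ B_based; have [L1 _ bB] := B_based.
have /countable_injP[j j_inj] := basis_countable B_based.
have jI b b' : B b -> B b' -> j b = j b' -> b = b'.
  by move=> Bb Bb'; apply: j_inj; rewrite inE.
have [_ [e [_ e1 _ _ _]]] := bB.
pose u i := xget 0 [set b | B b /\ j b = i].
have uj b : B b -> u (j b) = b.
  by move=> Bb; rewrite /u; case: xgetP => [b' -> [/= Bb' /jI ->]|/(_ b)[]//].
have u_le1 i : `|u i| <= 1.
  by rewrite /u; case: xgetP => [b _ [/= /e1[->]]|]; rewrite ?normr0.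
have [y yP] := copies_sequence K1 X_univ u_le1.
(* Finite sums over the basis are sums over an initial segment of indices. *)
have sumE (s : {fset U}) (a : U -> R) : [set` s] `<=` B -> exists n (x : 'rV[R]_n),
    (forall (Z : lmodType R) (w : nat -> Z) (J : pred nat),
      \sum_(i < n | J i) x 0 i *: w i = \sum_(b <- s | J (j b)) a b *: w (j b)) /\
    forall i, `|x 0 i| <= L * `|\sum_(b <- s) a b *: b|.
  move=> sB; pose n := (\max_(b <- s) j b).+1.
  pose x : 'rV[R]_n := \row_i \sum_(b <- s | j b == i) a b.
  exists n, x; split.
    move=> Z w J; under eq_bigr do rewrite mxE scaler_suml.
    rewrite (exchange_big_dep (fun b => J (j b)))/=; last by move=> i b Ji /eqP ->.
    rewrite big_seq_cond [RHS]big_seq_cond; apply: eq_bigr => b /andP[bs Jb].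
    have jn : (j b < n)%N by rewrite ltnS; exact: leq_bigmax_seq.
    rewrite (big_pred1 (Ordinal jn))// => i; rewrite /= -val_eqE/= eq_sym.
    by case: eqVneq => [->|]; rewrite ?Jb ?andbF.
  move=> i; rewrite mxE.
  have [[b bs /eqP jb]|nb] := pselect (exists2 b, b \in s & j b == i); last first.
    rewrite big1_seq ?normr0 ?mulr_ge0 ?(le_trans ler01 L1)// => b /andP[jb bs].
    by case: nb; exists b.
  have -> : `|\sum_(b <- s | j b == i) a b| = `|\sum_(b <- s | j b == i) a b *: b|.
    rewrite -[LHS]mulr1 -(e1 b (sB _ bs)).1 -normrZ scaler_suml; congr `|_|.
    rewrite big_seq_cond [RHS]big_seq_cond; apply: eq_bigr => b' /andP[b's /eqP jb'].
    by rewrite (@jI b b')//; [exact: sB|exact: sB|rewrite jb].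
  exact: (suppressive_id bB).
exists (fun b => y (j b)); split.
- by move=> b Bb; have [+ _] := yP (j b).+1; apply.
- exists (3 * L) => s a sB; have [n [x [xE xL]]] := sumE s a sB.
  rewrite -(xE X y predT) (yP n).2 -mulrA; apply: grid_norm_le => // J.
  rewrite xE big_seq_cond (eq_bigr (fun b => a b *: b)); last first.
    by move=> b /andP[/sB Bb _]; rewrite uj.
  by rewrite -big_seq_cond; exact: (suppressive_id bB).
exists 1 => s a sB; have [n [x [xE _]]] := sumE s a sB.
rewrite mul1r -(xE X y predT) (yP n).2.
apply: le_trans (grid_norm_ge u_le1 x); rewrite (xE U u predT).
rewrite big_seq [X in _ <= `|X|]big_seq (eq_bigr (fun b => a b *: u (j b)))// => b /sB Bb.
by rewrite uj.
Qed.

(** A continuous linear map and its continuous inverse on the image are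
    bounded. *)
Lemma B_isomorphic_embedding (R : realType) (X U : completeNormedModType R)
    (BX : set X) (B : set U) :
  based setT BX -> B_universal setT B -> exists f : X -> U,
    [/\ forall b, BX b -> B (f b), dominates BX id f & dominates BX f id].
Proof.
move=> BX_based B_univ.
have [M [BM [[[K' [_ [M_sub _ _] _]] _ _ BME] [T [S [[Tl Tc TM TB] [Sl Sc _ _] ST _]]]]]] :=
  B_univ X BX BX_based.
have Xs := submod_closed_setT X.
have [C TC] := continuous_linear_on_bounded Xs Tl Tc.
have [D SD] := continuous_linear_on_bounded M_sub Sl Sc.
have Tsum (s : {fset X}) (a : X -> R) :
    \sum_(b <- s) a b *: T b = T (\sum_(b <- s) a b *: b) by rewrite (linear_on_sum Xs Tl).
exists T; split.
- move=> b Bb; have : BM (T b) by apply: TB; exists b.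
  by rewrite BME => -[].
- by exists C => s a _; rewrite Tsum; exact: TC.
exists D => s a _; rewrite Tsum -[X in `|X| <= _]ST//; apply: SD.
by apply: TM; eexists.
Qed.

Theorem corollary5p9 (R : realType) (K : R) (hK : 1 <= K)
  (UK : completeNormedModType R) (BK : set UK)
  (based_UK : K_based K setT BK)
  (rational_UK : rational_based setT BK)
  (RI_universal_UK : RI_universal K setT BK)
  (U : completeNormedModType R) (B : set U)
  (based_U : based setT B)
  (B_universal_U : B_universal setT B) :
  B_isomorphic setT BK setT B.
Proof.
have [f [fB f_bnd f_below]] := B_isomorphic_embedding
  (ex_intro (fun K => K_based K setT BK) K based_UK) B_universal_U.
have [L B_based] := based_U.
have [g [gB g_bnd g_below]] := RI_universal_embedding hK RI_universal_UK B_based.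
have [_ _ basis_BK] := based_UK; have [_ _ basis_B] := B_based.
exact: (based_cantor_bernstein basis_BK basis_B fB gB).
Qed.
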